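(* Let $Q$ be an acyclic quiver and let $\mathcal{Q}^\bullet=\{Q^1,\dots,Q^\ell\}$ be a Dynkin subquiver partition of $Q$. Let $\Phi(Q,\mathcal{Q}^\bullet)=\bigcup_{j=1}^\ell \Phi^j$ and $r=|\Phi(Q,\mathcal{Q}^\bullet)|$. A total ordering $$\phi_1\prec\phi_2\prec\cdots\prec\phi_r$$ of the elements of $\Phi(Q,\mathcal{Q}^\bullet)$ satisfying the two conditions (i) if $u<v$ and $\phi_u,\phi_v\in\Phi^j$ lie in the same set $\Phi^j$, then $\lambda(\phi_u,\phi_v)\ge 0$; (ii) if $u<v$ and $\phi_u\in\Phi^j$, $\phi_v\in\Phi^{j'}$ with $j\ne j'$, then $\lambda(\phi_u,\phi_v)\le 0$ exists (but is not unique) if and only if $\mathcal{Q}^\bullet$ is admissible. In particular, if $\mathcal{Q}^\bullet$ is ordered, then an allowed total order on $\Phi(Q,\mathcal{Q}^\bullet)$ is $$\Phi^1\prec\Phi^2\prec\cdots\prec\Phi^\ell$$ (all elements of $\Phi^j$ precede all elements of $\Phi^{j'}$ when $j<j'$), where each $\Phi^j$ is ordered according to condition (i).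
   Context: A quiver $Q=(Q_0,Q_1)$ is a finite set of vertices $Q_0$ and a finite set of arrows $Q_1$ (multiple arrows allowed), each $a\in Q_1$ having a tail $ta\in Q_0$ and a head $ha\in Q_0$. It is acyclic if it has no oriented cycles (in particular no loops). $D_Q=\mathbb{N}^{Q_0}$ is the monoid of dimension vectors, with basis $e_i$, $i\in Q_0$. The Euler form is $\chi(\gamma_1,\gamma_2)=\sum_{i\in Q_0}\gamma_1(i)\gamma_2(i)-\sum_{a\in Q_1}\gamma_1(ta)\gamma_2(ha)$ for $\gamma_1,\gamma_2\in D_Q$, and $\lambda(\gamma_1,\gamma_2)=\chi(\gamma_2,\gamma_1)-\chi(\gamma_1,\gamma_2)$. Thus $\lambda(e_i,e_j)$ is the number of arrows $i\to j$ minus the number of arrows $j\to i$ in $Q$. A Dynkin quiver is an orientation of a simply-laced Dynkin diagram (type $A$, $D$ or $E$). Its simple roots $\alpha_i$ are in bijection with the vertices $i$; a positive root $\sum_i d^i\alpha_i$ is identified with the dimension vector $\sum_i d^i e_i$. A subquiver $Q'$ of $Q$ is a quiver with $Q'_0\subseteq Q_0$ and $Q'_1\subseteq Q_1$ (not necessarily full). A Dynkin subquiver partition $\mathcal{Q}^\bullet=\{Q^1,\dots,Q^\ell\}$ of $Q$ is a collection of disjoint, nonempty, connected Dynkin subquivers of $Q$ with $Q_0=\bigcup_{j}Q^j_0$ (so each vertex lies in exactly one $Q^j_0$, while arrows of $Q$ need not lie in any $Q^j_1$). $\Phi^j$ denotes the set of positive roots of $Q^j$, regarded as a subset of $D_Q$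 by extending dimension vectors by zero outside $Q^j_0$. The quiver $P(Q,\mathcal{Q}^\bullet)$ is obtained from $Q$ by contracting each subquiver $Q^j$ to a single vertex labeled $Q^j$; its arrows are identified with the arrows in $Q_1\setminus\bigcup_j Q^j_1$, with tail (head) the vertex $Q^j$ whose vertex set contains the original tail (head). $\mathcal{Q}^\bullet$ is admissible if $P(Q,\mathcal{Q}^\bullet)$ is acyclic (no loops and no oriented cycles). $\mathcal{Q}^\bullet$ is ordered if the subquivers are labeled so that every arrow $a$ of $P(Q,\mathcal{Q}^\bullet)$ has $ha=Q^j$ and $ta=Q^{j'}$ with $j<j'$.
   Formalization: The direction ''an ordering exists implies admissible'' is proved assuming P(Q,Q^•) has no loops (it fails for two arrows 1→2 with only one in the part), and ''not unique'' is read as ''need not be unique'' (one vertex has only one ordering). *)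

(* Defs.v *)
From HB Require Import structures.
From mathcomp Require Import all_boot all_order all_algebra.

Set Implicit Arguments.
Unset Strict Implicit.
Unset Printing Implicit Defensive.

Import Order.TTheory GRing.Theory Num.Theory.

Local Open Scope ring_scope.

Record quiver := Quiver {
  vertex : finType;
  arrow : finType;
  tl : arrow -> vertex;
  hd : arrow -> vertex }.

(* A nonempty list c of arrows with [cycle composable c] is an oriented cycle;
   a loop is the case where c has length 1. *)
Definition composable (Q : quiver) : rel (arrow Q) :=
  fun a b => hd a == tl b.

Definition acyclic (Q : quiver) : Prop :=
  forall c : seq (arrow Q), c != [::] -> ~~ cycle (@composable Q) c.

Definition loopless (Q : quiver) : Prop :=
  forall a : arrow Q, tl a != hd a.

Definition dimvec (Q : quiver) := {ffun vertex Q -> nat}.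

Definition euler (Q : quiver) (g1 g2 : dimvec Q) : int :=
  \sum_(i : vertex Q) (g1 i * g2 i)%:Z
  - \sum_(a : arrow Q) (g1 (tl a) * g2 (hd a))%:Z.

Definition lambda (Q : quiver) (g1 g2 : dimvec Q) : int :=
  euler g2 g1 - euler g1 g2.

Definition line_adj (i j : nat) : bool := (i.+1 == j) || (j.+1 == i).

Definition typeA (n : nat) : rel 'I_n := fun i j => line_adj i j.

(* The line 0 - 1 - ... - (n-2), with the extra vertex n-1 joined to vertex b. *)
Definition branched (n b : nat) : rel 'I_n := fun i j =>
  [|| [&& i < n.-1, j < n.-1 & line_adj i j],
      (i == b :> nat) && (j == n.-1 :> nat)
    | (j == b :> nat) && (i == n.-1 :> nat)]%N.

Inductive dynkin_diagram (n : nat) : rel 'I_n -> Prop :=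
| Dynkin_A : (1 <= n)%N -> dynkin_diagram (@typeA n)
| Dynkin_D : (4 <= n)%N -> dynkin_diagram (@branched n (n - 3)%N)
| Dynkin_E : (6 <= n <= 8)%N -> dynkin_diagram (@branched n 2).

(* Q is an orientation of a connected simply-laced Dynkin diagram: under a
   bijection of the vertices, any two vertices (possibly equal) are joined by
   one arrow if they are adjacent in the diagram and by none otherwise. *)
Definition dynkin (Q : quiver) : Prop :=
  exists (n : nat) (e : rel 'I_n) (f : vertex Q -> 'I_n),
    [/\ dynkin_diagram e, bijective f
      & forall v w : vertex Q,
          #|[set a : arrow Q | (tl a == v) && (hd a == w)
                            || (tl a == w) && (hd a == v)]|
          = e (f v) (f w) :> nat].

(* The simple reflection s_i, in coordinates on the simple roots, for the
   simply-laced Cartan matrix of the underlying graph of a loopless quiver. *)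
Definition reflection (Q : quiver) (i : vertex Q)
    (x : {ffun vertex Q -> int}) : {ffun vertex Q -> int} :=
  [ffun v => if v == i then
               \sum_(a : arrow Q | tl a == i) x (hd a)
               + \sum_(a : arrow Q | hd a == i) x (tl a) - x i
             else x v].

(* The union of the Weyl group orbits of the simple roots. *)
Inductive root (Q : quiver) : {ffun vertex Q -> int} -> Prop :=
| root_simple (i : vertex Q) : root [ffun v => (v == i)%:R]
| root_reflection (i : vertex Q) (x : {ffun vertex Q -> int}) :
    root x -> root (reflection i x).

Definition positive_root (Q : quiver) (d : dimvec Q) : Prop :=
  root [ffun v => (d v)%:Z].

(* Subquivers need not be full. *)
Record subquiver (Q : quiver) := Subquiver {
  sq_vertex : {set vertex Q};
  sq_arrow : {set arrow Q};
  sq_tl : forall a, a \in sq_arrow -> tl a \in sq_vertex;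
  sq_hd : forall a, a \in sq_arrow -> hd a \in sq_vertex }.

Definition quiver_of (Q : quiver) (S : subquiver Q) : quiver :=
  @Quiver {v : vertex Q | v \in sq_vertex S} {a : arrow Q | a \in sq_arrow S}
    (fun a => exist _ (tl (val a)) (sq_tl (valP a)))
    (fun a => exist _ (hd (val a)) (sq_hd (valP a))).

Definition extend (Q : quiver) (S : subquiver Q) (d : dimvec (quiver_of S)) :
    dimvec Q :=
  [ffun v => if insub v is Some u then d u else 0%N].

(* Nonemptiness and connectedness of the parts are implied by [dp_dynkin]. *)
Record dynkin_partition (Q : quiver) := DynkinPartition {
  dp_size : nat;
  dp_part : 'I_dp_size -> subquiver Q;
  dp_dynkin : forall j, dynkin (quiver_of (dp_part j));
  dp_disjoint : forall j j', j != j' ->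
    [disjoint sq_vertex (dp_part j) & sq_vertex (dp_part j')];
  dp_cover : forall v, exists j, v \in sq_vertex (dp_part j) }.

Arguments dp_part {Q} _ _.

Definition block (Q : quiver) (P : dynkin_partition Q) (v : vertex Q) :
    'I_(dp_size P) :=
  xchoose (@dp_cover Q P v).

(* The quiver P(Q, Q^.): an arrow of Q outside all the parts, both of whose
   ends lie in the same part, becomes a loop. *)
Definition contraction (Q : quiver) (P : dynkin_partition Q) : quiver :=
  @Quiver 'I_(dp_size P)
    {a : arrow Q | a \notin \bigcup_j sq_arrow (dp_part P j)}
    (fun a => block P (tl (val a)))
    (fun a => block P (hd (val a))).

Definition admissible (Q : quiver) (P : dynkin_partition Q) : Prop :=
  acyclic (contraction P).

Definition ordered (Q : quiver) (P : dynkin_partition Q) : Prop :=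
  forall a : arrow (contraction P), (hd a < tl a)%N.

Definition Phi_part (Q : quiver) (P : dynkin_partition Q) (j : 'I_(dp_size P))
    (d : dimvec Q) : Prop :=
  exists2 d' : dimvec (quiver_of (dp_part P j)), positive_root d' & d = extend d'.

Arguments Phi_part {Q} P j d.

Definition Phi (Q : quiver) (P : dynkin_partition Q) (d : dimvec Q) : Prop :=
  exists j, Phi_part P j d.

(* A total ordering phi_1 < ... < phi_r of Phi is the list of its elements in
   increasing order. *)
Definition total_ordering (Q : quiver) (P : dynkin_partition Q)
    (s : seq (dimvec Q)) : Prop :=
  uniq s /\ forall d, d \in s <-> Phi P d.

Definition precedes (T : eqType) (s : seq T) (x y : T) : bool :=
  (index x s < index y s)%N.

(* The form lambda in the next two definitions is that of Q. *)
Definition condition_i (Q : quiver) (P : dynkin_partition Q)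
    (s : seq (dimvec Q)) : Prop :=
  forall (j : 'I_(dp_size P)) (x y : dimvec Q),
    Phi_part P j x -> Phi_part P j y -> precedes s x y -> 0 <= lambda x y.

Definition condition_ii (Q : quiver) (P : dynkin_partition Q)
    (s : seq (dimvec Q)) : Prop :=
  forall (j j' : 'I_(dp_size P)) (x y : dimvec Q),
    j != j' -> Phi_part P j x -> Phi_part P j' y -> precedes s x y ->
    lambda x y <= 0.

Definition allowed_ordering (Q : quiver) (P : dynkin_partition Q)
    (s : seq (dimvec Q)) : Prop :=
  [/\ total_ordering P s, condition_i P s & condition_ii P s].

(* A total ordering of the shape Phi^1 < Phi^2 < ... < Phi^l, each Phi^j being
   ordered according to condition (i). *)
Definition blockwise_ordering (Q : quiver) (P : dynkin_partition Q)
    (s : seq (dimvec Q)) : Prop :=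
  [/\ total_ordering P s, condition_i P s
    & forall (j j' : 'I_(dp_size P)) (x y : dimvec Q),
        (j < j')%N -> Phi_part P j x -> Phi_part P j' y -> precedes s x y].

(* Main.v *)
Require Import Defs.
From mathcomp Require Import all_boot all_order all_algebra.
From mathcomp Require Import zify ring.
From Stdlib Require Import Classical.

(** Existence.  Let K be a Dynkin quiver and i a source of K.  Reflecting at i
turns i into a sink, transports the Euler form of K to that of the reflected
quiver, and maps the positive roots other than e_i to the positive roots other
than e_i.  Moreover lambda(e_i, y) = y_i + (s_i y)_i is nonnegative for every
positive root y different from e_i.  So e_i may be listed first, and the other
roots are listed by applying the same recipe to the reflected quiver and
reflecting back ([lambda_along_sorting]).  Every root is reached: if the
successive reflections at sources kept x positive for ever, then, the roots
being finite in number, the powers of the Coxeter element on x would be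
periodic, and the sum over a period would be a nonzero vector fixed by all
simple reflections; but such a vector is orthogonal to everything, contrary to
the definiteness of the form ([walk_escapes]).  Definiteness itself is checked
diagram by diagram, by completing squares along the arms that meet in the
branch vertex ([dynkin_diagram_definite]).

If the contraction is acyclic, it has a function to the integers that decreases
along arrows.  Listing the blocks by increasing values of it, all arrows
between different blocks go from later blocks to earlier ones, and this is what
condition (ii) asks for ([rank_ordering], [rank_ordering_allowed]).

Converse.  Each block carries a root d_j with full support.  If there are
arrows from block j to block j' and none back, then lambda(d_j', d_j) is
negative, so that d_j' comes before d_j; if this holds for every arrow of the contraction, the
position of d_j decreases along arrows and there is no oriented cycle.  What
remains is to exclude arrows in both directions between blocks j and j'
([no_two_cycle]).  Take such a pair of opposite arrows a and b, joined inside j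
by a path p from the tail of a to the head of b and inside j' by a path q from
the head of a to the tail of b, with p and q as short as possible in total.
Then p and q are induced paths, so the sums of the vertices of their initial
and final segments are roots, and all arrows between p and q are parallel to a
or b.  For every splitting of p into an initial segment p1 and a final segment
p2, condition (ii) puts the root of p2 before the root of q, and the latter
before the root of p1; condition (i) then forces the arrow joining p1 and p2 to
point towards p1.  So p is an oriented path backwards, likewise q is an
oriented path forwards, and together with a and b they form an oriented cycle
of the quiver. *)

Set Implicit Arguments.
Unset Strict Implicit.
Unset Printing Implicit Defensive.

Import Order.TTheory GRing.Theory Num.Theory.
Local Open Scope ring_scope.

(** * Reflections and the Euler form on an integral lattice *)

Section Lattice.

Variables (V : finType) (A : V -> V -> int).
Hypothesis A_sym : forall v w, A v w = A w v.
Hypothesis A_diag : forall v, A v v = 0.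
Hypothesis A_ge0 : forall v w, 0 <= A v w.

Local Notation vec := {ffun V -> int}.

Definition nbr_sum (x : vec) (v : V) : int := \sum_w A v w * x w.

Definition refl (i : V) (x : vec) : vec :=
  [ffun v => if v == i then nbr_sum x i - x i else x v].

(** The symmetrized Euler form, written (x, y) in the comments; roots satisfy
(x, x) = 2. *)
Definition cartan (x y : vec) : int := \sum_v x v * (2 * y v - nbr_sum y v).

Definition delta (i : V) (c : int) : vec := [ffun v => if v == i then c else 0].

Definition nonneg (x : vec) : bool := [forall v, 0 <= x v].

Lemma nbr_sumD x y v : nbr_sum (x + y) v = nbr_sum x v + nbr_sum y v.
Proof.
by rewrite -big_split; apply: eq_bigr => w _; rewrite ffunE mulrDr.
Qed.

Lemma nbr_sum_delta i c v : nbr_sum (delta i c) v = A v i * c.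
Proof.
rewrite /nbr_sum (bigD1 i) //= ffunE eqxx big1 ?addr0 // => w /negbTE wi.
by rewrite ffunE wi mulr0.
Qed.

Lemma cartanDl x y z : cartan (x + y) z = cartan x z + cartan y z.
Proof.
by rewrite -big_split; apply: eq_bigr => v _; rewrite ffunE mulrDl.
Qed.

Lemma cartanNl x z : cartan (- x) z = - cartan x z.
Proof.
by rewrite -sumrN; apply: eq_bigr => v _; rewrite ffunE mulNr.
Qed.

Lemma cartanC x y : cartan x y = cartan y x.
Proof.
have E a b : cartan a b = 2 * \sum_v a v * b v - \sum_v \sum_w A v w * (a v * b w).
  rewrite mulr_sumr -sumrB; apply: eq_bigr => v _.
  rewrite mulrBr /nbr_sum mulr_sumr; congr (_ - _); first by ring.
  by apply: eq_bigr => w _; ring.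
rewrite !E exchange_big /=; congr (_ * _ - _).
  by apply: eq_bigr => v _; rewrite mulrC.
by apply: eq_bigr => v _; apply: eq_bigr => w _; rewrite A_sym; ring.
Qed.

Lemma cartanDr x y z : cartan x (y + z) = cartan x y + cartan x z.
Proof. by rewrite cartanC cartanDl !(cartanC x). Qed.

Lemma cartanNr x y : cartan x (- y) = - cartan x y.
Proof. by rewrite cartanC cartanNl cartanC. Qed.

Lemma cartan_delta i c y : cartan (delta i c) y = c * (2 * y i - nbr_sum y i).
Proof.
rewrite /cartan (bigD1 i) //= ffunE eqxx big1 ?addr0 // => w /negbTE wi.
by rewrite ffunE wi mul0r.
Qed.

Lemma reflE i x : refl i x = x + delta i (nbr_sum x i - 2 * x i).
Proof.
by apply/ffunP=> v; rewrite !ffunE; case: eqP => [->|_]; [ring|rewrite addr0].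
Qed.

Lemma refl_at i x : refl i x i = nbr_sum x i - x i.
Proof. by rewrite ffunE eqxx. Qed.

Lemma refl_off i x v : v != i -> refl i x v = x v.
Proof. by rewrite ffunE => /negbTE ->. Qed.

Lemma nbr_sum_refl i x : nbr_sum (refl i x) i = nbr_sum x i.
Proof. by rewrite reflE nbr_sumD nbr_sum_delta A_diag mul0r addr0. Qed.

Lemma reflK i : involutive (refl i).
Proof.
move=> x; apply/ffunP=> v; rewrite ffunE; case: eqP => [->|/eqP vi].
  by rewrite nbr_sum_refl refl_at; ring.
exact: refl_off.
Qed.

Lemma reflD i x y : refl i (x + y) = refl i x + refl i y.
Proof.
apply/ffunP=> v; rewrite !ffunE; case: eqP => // _.
by rewrite nbr_sumD; ring.
Qed.

Lemma cartan_addZ z i c : cartan (z + delta i c) (z + delta i c) =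
  cartan z z + 2 * c * (2 * z i - nbr_sum z i) + 2 * c ^+ 2.
Proof.
rewrite cartanDl !cartanDr (cartanC z (delta i c)) !cartan_delta.
by rewrite nbr_sum_delta A_diag ffunE eqxx; ring.
Qed.

Lemma cartan_refl i x : cartan (refl i x) (refl i x) = cartan x x.
Proof. by rewrite reflE cartan_addZ; ring. Qed.

Hypothesis cartan_gt0 : forall x : vec, x != 0 -> 0 < cartan x x.

Lemma cartan_ge0 x : 0 <= cartan x x.
Proof.
have [->|/cartan_gt0/ltW//] := eqVneq x 0.
by rewrite /cartan big1 // => v _; rewrite ffunE mul0r.
Qed.

Lemma cartan_le0 x : cartan x x <= 0 -> x = 0.
Proof. by apply: contraTeq => /cartan_gt0; rewrite ltNge. Qed.

(** Roots are separated by their residues modulo 3: if x - y = 3w, then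
9 (w, w) = (x - y, x - y) is at most (x - y, x - y) + (x + y, x + y) = 8.
Finiteness of the set of roots follows. *)
Lemma eq_mod3 x y : cartan x x = 2 -> cartan y y = 2 ->
  (forall v, (x v = y v %[mod 3])%Z) -> x = y.
Proof.
move=> Bx By xy; pose w : vec := [ffun v => ((x v - y v) %/ 3)%Z].
have xyw : x - y = w + w + w.
  apply/ffunP=> v; rewrite !ffunE; move/eqP: (xy v).
  by rewrite eqz_mod_dvd => /dvdzP [q ->]; rewrite mulzK //; lia.
have Bd : cartan (x - y) (x - y) = 9 * cartan w w.
  by rewrite xyw !(cartanDl, cartanDr); ring.
have Bs : cartan (x - y) (x - y) + cartan (x + y) (x + y) = 8.
  by rewrite !(cartanDl, cartanDr, cartanNl, cartanNr) Bx By; ring.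
have w0 : w = 0 by apply: cartan_le0; have := cartan_ge0 (x + y); lia.
by move: xyw; rewrite w0 !addr0; apply: subr0_eq.
Qed.

(** A simple reflection only moves one coordinate.  If that coordinate became
negative, y = s_i x would be z + c e_i with c < 0, z nonnegative and z_i = 0.
Then (y, y) >= (z, z) + 2 c^2; and (y, y) = 2 leaves only z = 0 and c = -1,
that is x = e_i. *)
Lemma refl_nonneg i x : nonneg x -> cartan x x = 2 -> x != delta i 1 ->
  nonneg (refl i x).
Proof.
move=> /forallP x0 Bx; apply: contraNT => nn.
set y := refl i x in nn *; set c := y i.
have c_lt0 : c < 0.
  rewrite ltNge; apply: contraNN nn => c0; apply/forallP=> v.
  by have [->//|vi] := eqVneq v i; rewrite refl_off.
pose z := y - delta i c.
have zE v : z v = y v - (if v == i then c else 0).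
  by rewrite /z; move: (y) => y'; rewrite !ffunE.
have zi : z i = 0 by rewrite zE eqxx subrr.
have nbr_z : 0 <= nbr_sum z i.
  apply: sumr_ge0 => w _; have [->|wi] := eqVneq w i; first by rewrite zi mulr0.
  by apply: mulr_ge0 => //; rewrite zE (negbTE wi) subr0 refl_off.
have yz : y = z + delta i c by rewrite subrK.
have By : cartan y y = cartan z z + 2 * c ^+ 2 - 2 * (c * nbr_sum z i).
  by rewrite yz cartan_addZ zi; ring.
have {}By : cartan z z + 2 * c ^+ 2 - 2 * (c * nbr_sum z i) = 2.
  by rewrite -By /y cartan_refl.
have cn : c * nbr_sum z i <= 0 by rewrite nmulr_rle0.
have c2 : 1 <= c ^+ 2 by rewrite expr2; nia.
have z0 : z = 0 by apply: cartan_le0; lia.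
have c1 : c = -1.
  move: By; rewrite z0 [nbr_sum _ _]big1 => [|w _]; last by rewrite ffunE mulr0.
  rewrite [cartan _ _]big1 => [|w _]; last by rewrite ffunE mul0r.
  by rewrite expr2; nia.
apply/eqP; rewrite -(reflK i x) -/y yz z0 add0r c1.
apply/ffunP=> v; rewrite !ffunE; case: eqP => // _.
by rewrite nbr_sum_delta A_diag eqxx.
Qed.

Lemma refl_fixed0 y : (forall i, refl i y = y) -> y = 0.
Proof.
move=> fix_y; apply: cartan_le0; rewrite /cartan big1 // => v _.
by have := refl_at v y; rewrite fix_y => h; rewrite (_ : 2 * y v - _ = 0) ?mulr0 //; lia.
Qed.

(** The Euler form of the quiver whose arrows follow the order of the vertices
in [l].  An acyclic orientation is thus encoded by an order of the vertices, and
turning a source into a sink is a rotation of that order. *)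
Fixpoint euler_along (l : seq V) (x y : vec) : int :=
  if l is i :: l' then
    x i * y i - x i * (\sum_(j <- l') A i j * y j) + euler_along l' x y
  else 0.

Lemma eq_euler_along l (x x' y y' : vec) :
  {in l, x =1 x'} -> {in l, y =1 y'} -> euler_along l x y = euler_along l x' y'.
Proof.
elim: l => //= i l IH ex ey.
rewrite ex ?ey ?mem_head // (IH) => [|v vl|v vl]; last 2 first.
- by apply: ex; rewrite inE vl orbT.
- by apply: ey; rewrite inE vl orbT.
congr (_ - _ * _ + _); apply: eq_big_seq => j jl.
by rewrite ey // inE jl orbT.
Qed.

Lemma euler_along_rcons l i x y :
  euler_along (rcons l i) x y =
  euler_along l x y + x i * y i - (\sum_(j <- l) A i j * x j) * y i.
Proof.
elim: l => [|k l IH] /=; first by rewrite !big_nil; ring.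
rewrite IH -cats1 big_cat big_seq1 big_cons (A_sym k i) /=; ring.
Qed.

Lemma nbr_sum_order i l x : perm_eq (i :: l) (index_enum V) ->
  nbr_sum x i = \sum_(j <- l) A i j * x j.
Proof.
by move=> il; rewrite /nbr_sum -(perm_big _ il) big_cons /= A_diag mul0r add0r.
Qed.

(** Reflecting at a source: both sides differ from the form along [l] by
minus the product of x_i with the i-th coordinate of the reflection of y. *)
Lemma euler_along_rot i l x y : perm_eq (i :: l) (index_enum V) ->
  euler_along (rcons l i) (refl i x) (refl i y) = euler_along (i :: l) x y.
Proof.
move=> il; have := perm_uniq il; rewrite index_enum_uniq /= => /andP[i_l _].
have off z : {in l, refl i z =1 z}.
  by move=> v vl; rewrite refl_off //; apply: contraNneq i_l => <-.
rewrite euler_along_rcons /= (eq_euler_along (off x) (off y)) -!(nbr_sum_order _ il).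
by rewrite nbr_sum_refl !refl_at; ring.
Qed.

Lemma euler_along_head i l x : perm_eq (i :: l) (index_enum V) ->
  euler_along (i :: l) (delta i 1) x = - refl i x i.
Proof.
move=> il; have := perm_uniq il; rewrite index_enum_uniq /= => /andP[i_l _].
rewrite -(nbr_sum_order _ il) refl_at (@eq_euler_along l _ 0 x x) //; last first.
  by move=> v vl; rewrite !ffunE; case: eqP vl i_l => // -> ->.
rewrite ffunE eqxx (_ : euler_along l 0 x = 0); first by ring.
by elim: l {il i_l} => //= k l ->; rewrite ffunE !mul0r subr0.
Qed.

Lemma euler_along_headr i l x : perm_eq (i :: l) (index_enum V) ->
  euler_along (i :: l) x (delta i 1) = x i.
Proof.
move=> il; have := perm_uniq il; rewrite index_enum_uniq /= => /andP[i_l _].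
rewrite -(nbr_sum_order _ il) (@eq_euler_along l x x _ 0) //; last first.
  by move=> v vl; rewrite !ffunE; case: eqP vl i_l => // -> ->.
rewrite ffunE eqxx nbr_sum_delta A_diag (_ : euler_along l x 0 = 0); first by ring.
elim: l {il i_l} => //= k l ->; rewrite ffunE big1 ?mulr0 ?subr0 ?addr0 //.
by move=> j _; rewrite ffunE mulr0.
Qed.

Definition lambda_along l x y := euler_along l y x - euler_along l x y.

(** Successive reflections at the current source, which then becomes the last
vertex of the order. *)
Fixpoint walk (k : nat) (l : seq V) (x : vec) : vec :=
  match k, l with
  | k'.+1, i :: l' => walk k' (rcons l' i) (refl i x)
  | _, _ => x
  end.

Definition coxeter (l : seq V) (x : vec) : vec :=
  foldl (fun y i => refl i y) x l.

Lemma walk_coxeter l1 l2 k x :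
  walk (size l1 + k) (l1 ++ l2) x = walk k (l2 ++ l1) (coxeter l1 x).
Proof.
elim: l1 l2 x => [|i l1 IH] l2 x /=; first by rewrite cats0.
by rewrite rcons_cat IH cat_rcons.
Qed.

Lemma walk_iter l m x : walk (m * size l) l x = iter m (coxeter l) x.
Proof.
elim: m x => [|m IH] x; first by rewrite mul0n; case: l.
have := walk_coxeter l [::] (m * size l) x; rewrite cats0 -mulSn => ->.
by rewrite IH -iterSr.
Qed.

Lemma coxeterD l x y : coxeter l (x + y) = coxeter l x + coxeter l y.
Proof. by elim: l x y => //= i l IH x y; rewrite reflD IH. Qed.

Lemma coxeter_off l x v : v \notin l -> coxeter l x v = x v.
Proof.
elim: l x => //= i l IH x; rewrite inE negb_or => /andP[vi vl].
by rewrite IH // refl_off.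
Qed.

Lemma cartan_coxeter l x : cartan (coxeter l x) (coxeter l x) = cartan x x.
Proof. by elim: l x => //= i l IH x; rewrite IH cartan_refl. Qed.

(** Each vertex occurs once, so that its coordinate is changed by one factor of
the Coxeter element only; this factor must already fix the vector. *)
Lemma coxeter_fixed l x : uniq l -> coxeter l x = x ->
  {in l, forall i, refl i x = x}.
Proof.
elim: l => //= i l IH /andP[il ul] fx.
have fix_i : refl i x = x.
  apply/ffunP=> v; have [->|vi] := eqVneq v i; last exact: refl_off.
  by rewrite -{2}fx coxeter_off.
rewrite fix_i in fx; move=> j; rewrite inE => /orP[/eqP ->//|].
exact: IH.
Qed.

Definition residues (x : vec) : {ffun V -> 'I_3} :=
  [ffun v => inord `|(x v %% 3)%Z|].

Lemma residues_inj x y : cartan x x = 2 -> cartan y y = 2 ->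
  residues x = residues y -> x = y.
Proof.
move=> Bx By r; apply: eq_mod3 => // v.
have /(congr1 (@nat_of_ord 3)) := congr1 (fun g : {ffun V -> 'I_3} => g v) r.
rewrite !ffunE !inordK; lia.
Qed.

(** Otherwise the orbit of x under the Coxeter element stays in the finite set of
vectors y with (y, y) = 2, and the sum over a period contradicts [refl_fixed0]. *)
Lemma walk_escapes l x : perm_eq l (index_enum V) -> cartan x x = 2 ->
  exists k, ~~ nonneg (walk k l x).
Proof.
move=> pl Bx; apply: NNPP => no_k.
have nn m : nonneg (iter m (coxeter l) x).
  by rewrite -walk_iter; apply/negbNE/negP => h; apply: no_k; exists (m * size l)%N.
have Bm m : cartan (iter m (coxeter l) x) (iter m (coxeter l) x) = 2.
  by elim: m => //= m IH; rewrite cartan_coxeter.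
pose N := #|{ffun V -> 'I_3}|.
pose g (k : 'I_N.+1) := residues (iter k (coxeter l) x).
have /injectivePn [j [k jk gjk]] : ~~ injectiveb g.
  apply/injectiveP => g_inj; have := leq_card g g_inj.
  by rewrite card_ord ltnn.
wlog {jk} jk : j k gjk / (j < k)%N.
  move=> W; have [jk'|kj|e] := ltngtP j k; [exact: (W j k)|exact: (W k j)|].
  by case/eqP: jk; apply: val_inj.
have {gjk} ejk := residues_inj (Bm j) (Bm k) gjk.
pose y := \sum_(j <= m < k) iter m (coxeter l) x.
have cox_y : coxeter l y = y.
  have -> : coxeter l y = \sum_(j <= m < k) iter m.+1 (coxeter l) x.
    apply: (big_morph (coxeter l) (@coxeterD l)).
    have := coxeterD l 0 0; rewrite addr0 => h.
    by apply: (addIr (coxeter l 0)); rewrite -h add0r.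
  apply/eqP; rewrite -subr_eq0 -sumrB.
  by rewrite (telescope_sumr (fun m => iter m (coxeter l) x) (ltnW jk)) -ejk subrr.
have y0 : y = 0.
  have ul : uniq l by rewrite (perm_uniq pl) index_enum_uniq.
  apply: refl_fixed0 => i; apply: (coxeter_fixed ul cox_y).
  by rewrite (perm_mem pl) mem_index_enum.
have x0 : iter j (coxeter l) x = 0.
  apply/ffunP=> v; rewrite [RHS]ffunE; apply/eqP; rewrite eq_le (forallP (nn j) v) andbT.
  have : y v = 0 by rewrite y0 ffunE.
  rewrite /y big_ltn // ffunE sum_ffunE => <-; rewrite lerDl.
  by apply: sumr_ge0 => m _; apply: (forallP (nn m) v).
have := Bm j; rewrite x0 /cartan big1 // => v _; by rewrite ffunE mul0r.
Qed.

(** The bound [N] on the exit times is the induction variable: reflecting at the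
source lowers all exit times by one.  The embedding [emb] is a parameter so that
the family stays the same while its image is reflected. *)
Lemma lambda_along_sorting (T : eqType) (N : nat) (l : seq V) (emb : T -> vec) (F : seq T) :
    perm_eq l (index_enum V) -> injective emb -> uniq F ->
    {in F, forall d, [/\ nonneg (emb d), cartan (emb d) (emb d) = 2
      & exists2 k, (k <= N)%N & ~~ nonneg (walk k l (emb d))]} ->
  exists2 s, perm_eq s F & pairwise (fun d d' => 0 <= lambda_along l (emb d) (emb d')) s.
Proof.
elim: N l emb F => [|N IH] l emb F pl inj_emb uF hF.
  exists [::] => //; case: F uF hF => // d F _ /(_ d (mem_head _ _)) [nn _ [[|//] _]].
  by case: (l) => [|??] /=; rewrite nn.
case: l pl hF => [|i l] pl hF.
  exists [::] => //; case: F uF hF => // d F _ /(_ d (mem_head _ _)) [nn _ [k _]].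
  by case: k => [|k] /=; rewrite nn.
have pl' : perm_eq (rcons l i) (index_enum V).
  by rewrite (perm_trans _ pl) // perm_rcons.
pose is_e d := emb d == delta i 1.
pose F1 := [seq d <- F | ~~ is_e d].
have [||s1 ps1 os1] := IH _ (refl i \o emb) F1 pl' _ (filter_uniq _ uF).
- exact: inj_comp (inv_inj (@reflK i)) inj_emb.
- move=> d; rewrite mem_filter => /andP[de dF]; have [nn Bd [k kN hk]] := hF d dF.
  split; [exact: refl_nonneg | by rewrite /= cartan_refl|].
  by case: k kN hk => [_|k kN hk]; [rewrite /= nn | exists k].
have os1' : pairwise (fun d d' => 0 <= lambda_along (i :: l) (emb d) (emb d')) s1.
  apply: sub_pairwise os1 => d d'; by rewrite /lambda_along /= !euler_along_rot.
have [/hasP[d0 d0F d0e]|/hasPn no] := boolP (has is_e F); last first.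
  exists s1 => //; rewrite (perm_trans ps1) //.
  by rewrite (_ : F1 = F) //; apply/all_filterP/allP.
exists (d0 :: s1); last first.
  rewrite /= os1' andbT; apply/allP => d; rewrite (perm_mem ps1) mem_filter.
  move=> /andP[de dF]; have [nn Bd _] := hF d dF.
  rewrite /lambda_along (eqP d0e) euler_along_head // euler_along_headr // opprK addr_ge0 //.
    exact: (forallP nn i).
  exact: (forallP (refl_nonneg nn Bd de) i).
rewrite (perm_trans (y := d0 :: F1)) ?perm_cons //.
rewrite perm_sym (perm_trans (perm_to_rem d0F)) // perm_cons rem_filter //.
rewrite /F1 (_ : filter _ F = filter (predC1 d0) F) //.
apply: eq_in_filter => d dF; congr (~~ _); apply/eqP/eqP => [de|->]; last exact/eqP.
by apply: inj_emb; rewrite de (eqP d0e).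
Qed.

End Lattice.

(** * Definiteness and connectedness of the Dynkin diagrams *)

(** The contribution to (u, u) of a path of [k] vertices attached to a vertex
that carries the coordinate [u k]. *)
Definition arm (u : nat -> int) (k : nat) : int :=
  \sum_(i < k) 2 * (u i * u i - u i * u i.+1).

Lemma armS u k : arm u k.+1 = arm u k + 2 * (u k * u k - u k * u k.+1).
Proof. by rewrite /arm big_ord_recr. Qed.

(** Completing the square at the last vertex of the arm; iterating this shows
that an arm of length k contributes at least - k / (k + 1) (u k)^2. *)
Lemma arm_square u k :
  k.+1%:Z * (k.+2%:Z * arm u k.+1 + k.+1%:Z * u k.+1 ^+ 2) =
  k.+2%:Z * (k.+1%:Z * arm u k + k%:Z * u k ^+ 2)
  + (k.+2%:Z * u k - k.+1%:Z * u k.+1) ^+ 2.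
Proof. by rewrite armS !intS; ring. Qed.

Lemma arm_bound u k : 0 <= k.+1%:Z * arm u k + k%:Z * u k ^+ 2.
Proof.
elim: k => [|k IH]; first by rewrite /arm big_ord0; lia.
rewrite -(pmulr_rge0 (x := k.+1%:Z)) // arm_square.
by rewrite addr_ge0 ?sqr_ge0 // mulr_ge0.
Qed.

Lemma arm_eq0 u k : u k = 0 -> arm u k <= 0 -> forall i, (i <= k)%N -> u i = 0.
Proof.
elim: k => [|k IH] uk ak i; first by rewrite leqn0 => /eqP ->.
rewrite leq_eqVlt => /orP[/eqP ->//|]; rewrite ltnS.
have := arm_square u k; have := arm_bound u k; rewrite uk.
set s := _ * arm u k + _ => s0 e.
have sq0 := sqr_ge0 (k.+2%:Z * u k - k.+1%:Z * 0).
have h1 : k.+1%:Z * (k.+2%:Z * arm u k.+1 + k.+1%:Z * 0 ^+ 2) <= 0.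
  by rewrite expr0n mulr0 addr0 !pmulr_rle0.
have h2 : 0 <= k.+2%:Z * s by rewrite mulr_ge0.
have uk0 : u k = 0.
  have : (k.+2%:Z * u k - k.+1%:Z * 0) ^+ 2 = 0 by lia.
  by move/eqP; rewrite sqrf_eq0 mulr0 subr0 mulf_eq0 => /orP[//|/eqP].
apply: IH => //; rewrite -(pmulr_rle0 (x := k.+1%:Z)) //.
have -> : k.+1%:Z * arm u k = s by rewrite /s uk0 expr0n mulr0 addr0.
rewrite -(pmulr_rle0 (x := k.+2%:Z)) //; lia.
Qed.

Definition rel_form (n : nat) (e : nat -> nat -> bool) (z : nat -> int) : int :=
  \sum_(i < n) z i * (2 * z i - \sum_(j < n) (e i j)%:R * z j).

Lemma rel_formS n (e : nat -> nat -> bool) z :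
  (forall i j, e i j = e j i) -> ~~ e n n ->
  rel_form n.+1 e z = rel_form n e z + 2 * z n * (z n - \sum_(i < n) (e i n)%:R * z i).
Proof.
move=> e_sym /negbTE enn; rewrite /rel_form !big_ord_recr /= enn.
have -> : \sum_(i < n) z i * (2 * z i - \sum_(j < n.+1) (e i j)%:R * z j) =
  rel_form n e z - z n * \sum_(i < n) (e i n)%:R * z i.
  rewrite /rel_form mulr_sumr -sumrB; apply: eq_bigr => i _.
  by rewrite big_ord_recr /=; ring.
rewrite mul0r addr0; have -> : \sum_(j < n) (e n j)%:R * z j = \sum_(i < n) (e i n)%:R * z i.
  by apply: eq_bigr => j _; rewrite e_sym.
by ring.
Qed.

Lemma eq_rel_form n (e e' : nat -> nat -> bool) z :
  (forall i j, (i < n)%N -> (j < n)%N -> e i j = e' i j) ->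
  rel_form n e z = rel_form n e' z.
Proof.
move=> ee; apply: eq_bigr => i _; congr (_ * (_ - _)).
by apply: eq_bigr => j _; rewrite ee.
Qed.

Lemma line_adjC i j : line_adj i j = line_adj j i.
Proof. by rewrite /line_adj orbC. Qed.

Lemma line_adjnn n : ~~ line_adj n n.
Proof. by rewrite /line_adj; lia. Qed.

Lemma sum_pick n k (e : nat -> bool) (z : nat -> int) :
  (k < n)%N -> (forall i, (i < n)%N -> e i = (i == k)) ->
  \sum_(i < n) (e i)%:R * z i = z k.
Proof.
move=> kn ek; rewrite (bigD1 (Ordinal kn)) //= ek // eqxx mul1r big1 ?addr0 //.
by move=> i ik; rewrite ek // (negbTE (_ : (i : nat) != k)) ?mul0r.
Qed.

Lemma line_form m z : rel_form m.+1 line_adj z = arm z m + 2 * z m ^+ 2.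
Proof.
elim: m => [|m IH].
  by rewrite /rel_form /arm !big_ord_recr !big_ord0 /= /line_adj /=; ring.
rewrite rel_formS ?line_adjnn //; last exact: line_adjC.
rewrite IH armS (sum_pick (k := m) (e := line_adj^~ m.+1)) //; first by ring.
by move=> i im; rewrite /line_adj; lia.
Qed.

Lemma arm_split b k z : arm z (b + k) + 2 * z (b + k)%N ^+ 2 =
  arm z b + arm (fun i => z (b + k - i)%N) k + 2 * z b ^+ 2.
Proof.
have -> : arm (fun i => z (b + k - i)%N) k =
  \sum_(i < k) 2 * (z (b + i).+1 * z (b + i).+1 - z (b + i)%N * z (b + i).+1).
  rewrite /arm (reindex_inj rev_ord_inj) /=; apply: eq_bigr => i _.
  have ik := ltn_ord i; rewrite (_ : b + k - (k - i.+1) = (b + i).+1)%N; last by lia.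
  by rewrite (_ : b + k - (k - i.+1).+1 = b + i)%N; [ring|lia].
elim: k => [|k IH]; first by rewrite addn0 big_ord0; ring.
rewrite addnS armS big_ord_recr /=.
by move/(canRL (addrK _)): IH => ->; ring.
Qed.

Definition branched_adj (n b i j : nat) : bool :=
  [|| [&& i < n.-1, j < n.-1 & line_adj i j],
      (i == b) && (j == n.-1) | (j == b) && (i == n.-1)]%N.

Lemma branched_form b k z : rel_form (b + k).+2 (branched_adj (b + k).+2 b) z =
  arm z b + arm (fun i => z (b + k - i)%N) k + 2 * z b ^+ 2
  + 2 * z (b + k).+1 * (z (b + k).+1 - z b).
Proof.
rewrite rel_formS; last 2 first.
- by move=> i j; rewrite /branched_adj line_adjC; lia.
- by rewrite /branched_adj /= ltnn; lia.
rewrite (eq_rel_form (e' := line_adj)); last first.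
  by move=> i j hi hj; rewrite /branched_adj /= hi hj /=; lia.
rewrite line_form arm_split
  (sum_pick (k := b) (e := (branched_adj (b + k).+2 b)^~ (b + k).+1)) ?ltnS ?leq_addr //.
by move=> i hi; rewrite /branched_adj /= ltnn andbF /=; lia.
Qed.

Lemma line_definite m z : rel_form m.+1 line_adj z <= 0 ->
  forall i, (i <= m)%N -> z i = 0.
Proof.
rewrite line_form => h; have := arm_bound z m => b.
have zm : z m = 0.
  apply/eqP; rewrite -sqrf_eq0 eq_le sqr_ge0 andbT; nia.
by apply: arm_eq0 => //; move: h; rewrite zm expr0n mulr0 addr0.
Qed.

(** The arms have b, k and 1 vertices; by [arm_bound] the form is positive as
soon as 1 / (b + 1) + 1 / (k + 1) + 1 / 2 > 1, which is the hypothesis after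
clearing denominators. *)
Lemma branched_definite b k z : (b * k < b + k + 3)%N ->
  rel_form (b + k).+2 (branched_adj (b + k).+2 b) z <= 0 ->
  forall i, (i <= (b + k).+1)%N -> z i = 0.
Proof.
move=> bk; rewrite branched_form; pose z' i := z (b + k - i)%N.
rewrite -/z'; have hb := arm_bound z b.
have hk : 0 <= k.+1%:Z * arm z' k + k%:Z * z b ^+ 2.
  by have := arm_bound z' k; rewrite {2}/z' addnK.
set w := z _.+1 => T0.
have zb : z b = 0.
  apply/eqP; rewrite -sqrf_eq0 eq_le sqr_ge0 andbT leNgt; apply/negP => c0.
  have w0 := sqr_ge0 (2 * w - z b).
  have h1 : 0 <= 2 * k.+1%:Z * (b.+1%:Z * arm z b + b%:Z * z b ^+ 2).
    by rewrite mulr_ge0.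
  have h2 : 0 <= 2 * b.+1%:Z * (k.+1%:Z * arm z' k + k%:Z * z b ^+ 2).
    by rewrite mulr_ge0.
  have h3 : 0 <= b.+1%:Z * k.+1%:Z * (2 * w - z b) ^+ 2 by rewrite mulr_ge0.
  have h4 : 0 < (b%:Z + k%:Z + 3 - b%:Z * k%:Z) * z b ^+ 2.
    by rewrite mulr_gt0 //; lia.
  have h5 : 2 * b.+1%:Z * k.+1%:Z *
    (arm z b + arm z' k + 2 * z b ^+ 2 + 2 * w * (w - z b)) <= 0.
    by rewrite pmulr_rle0.
  have E : 2 * b.+1%:Z * k.+1%:Z *
    (arm z b + arm z' k + 2 * z b ^+ 2 + 2 * w * (w - z b)) =
    2 * k.+1%:Z * (b.+1%:Z * arm z b + b%:Z * z b ^+ 2) +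
    2 * b.+1%:Z * (k.+1%:Z * arm z' k + k%:Z * z b ^+ 2) +
    b.+1%:Z * k.+1%:Z * (2 * w - z b) ^+ 2 +
    (b%:Z + k%:Z + 3 - b%:Z * k%:Z) * z b ^+ 2.
    by rewrite !intS; ring.
  move: h5; rewrite E leNgt => /negP; apply.
  by rewrite ltr_wpDl // !addr_ge0.
rewrite zb expr0n /= !mulr0 !addr0 !pmulr_rge0 // in hb hk.
have w2 := sqr_ge0 w.
rewrite zb expr0n mulr0 addr0 subr0 -mulrA -expr2 in T0.
have w0 : w = 0 by apply/eqP; rewrite -sqrf_eq0; apply/eqP; lia.
have hb0 : arm z b <= 0 by lia.
have hk0 : arm z' k <= 0 by lia.
have zk : z' k = 0 by rewrite /z' addnK.
move=> i; rewrite leq_eqVlt => /orP[/eqP ->//|]; rewrite ltnS => ibk.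
have [ib|bi] := leqP i b; first exact: arm_eq0 zb hb0 i ib.
by have := arm_eq0 zk hk0 (_ : b + k - i <= k)%N; rewrite /z' subKn // => -> //; lia.
Qed.

(** In type D the two arms of the line have n - 3 and 1 vertices, in type E
they have 2 and n - 4. *)
Lemma dynkin_diagram_definite n (e : rel 'I_n) (x : 'I_n -> int) :
  dynkin_diagram e -> \sum_i x i * (2 * x i - \sum_j (e i j)%:R * x j) <= 0 ->
  forall i, x i = 0.
Proof.
pose z k := if insub k is Some i then x i else 0.
have zx i : x i = z i by rewrite /z valK.
move=> de h i; rewrite zx; have i_n := ltn_ord i.
have {}h (e' : nat -> nat -> bool) : (forall i j : 'I_n, e i j = e' i j) ->
    rel_form n e' z <= 0.
  move=> ee; move: h; congr (_ <= _); apply: eq_bigr => k _.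
  rewrite zx; congr (_ * (_ - _)); apply: eq_bigr => j _.
  by rewrite ee zx.
case: de h => [n0|n4|n68] h.
- have {}h := h line_adj (fun _ _ => erefl).
  by apply: (@line_definite n.-1); rewrite ?prednK //; lia.
- have {}h := h (branched_adj n (n - 3)) (fun _ _ => erefl).
  have En : n = (n - 3 + 1).+2 by lia.
  by apply: (@branched_definite (n - 3) 1 z); [lia|rewrite -En|lia].
- have {}h := h (branched_adj n 2) (fun _ _ => erefl).
  have En : n = (2 + (n - 4)).+2 by lia.
  by apply: (@branched_definite 2 (n - 4) z); [lia|rewrite -En|lia].
Qed.

Lemma dynkin_diagram_card n (e : rel 'I_n) : dynkin_diagram e -> (0 < n)%N.
Proof. by case=> /=; lia. Qed.

Lemma dynkin_diagram_irr n (e : rel 'I_n) : dynkin_diagram e -> irreflexive e.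
Proof.
by case=> h i; apply/negbTE; rewrite ?/typeA ?/branched /line_adj; lia.
Qed.

Lemma dynkin_diagram_sym n (e : rel 'I_n) : dynkin_diagram e -> symmetric e.
Proof.
by case=> h i j; rewrite ?/typeA ?/branched /line_adj; lia.
Qed.

Lemma dynkin_diagram_connect n (e : rel 'I_n) :
  dynkin_diagram e -> forall i j, connect e i j.
Proof.
move=> de; have n0 := dynkin_diagram_card de; pose o := Ordinal n0.
suff to_o i : connect e i o.
  move=> i j; apply: connect_trans (to_o i) _.
  by rewrite (sym_connect_sym (dynkin_diagram_sym de)) to_o.
have line m : (forall i j : 'I_n, (i < m)%N -> (j < m)%N -> i.+1 = j -> e j i) ->
    forall i : 'I_n, (i < m)%N -> connect e i o.
  move=> he [k kn]; elim: k kn => [|k IH] kn km.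
    by rewrite (_ : Ordinal kn = o) ?connect0 //; apply: val_inj.
  apply: (connect_trans (y := Ordinal (ltnW kn))); last by apply: IH; exact: ltnW.
  by apply/connect1/he => //=; exact: ltnW.
have branch b (bn : (b < n.-1)%N) :
    e =2 @branched n b -> connect e i o.
  move=> eb; have li := line n.-1.
  have {}li : forall i : 'I_n, (i < n.-1)%N -> connect e i o.
    by apply: li => u v un vn uv; rewrite eb /branched un vn /line_adj; lia.
  have [?|ni] := ltnP i n.-1; first exact: li.
  have bn' : (b < n)%N by lia.
  apply: (connect_trans (y := Ordinal bn')); last exact: li.
  apply: connect1; rewrite eb /branched /=; have := ltn_ord i; lia.
case: de line branch => [n1|n4|n68] line branch.
- by apply: (line n) => // u v _ _ uv; rewrite /typeA /line_adj; lia.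
- by apply: (branch (n - 3)%N) => //; lia.
- by apply: (branch 2%N) => //; lia.
Qed.

(** * Rank functions and orderings *)

(** From left to right, the rank of a vertex is the number of vertices that can
be reached from it. *)
Lemma acyclicP (Q : quiver) : acyclic Q <->
  exists f : vertex Q -> nat, forall a : arrow Q, (f (hd a) < f (tl a))%N.
Proof.
split=> [acQ|[f fP] [//|a c] _]; last first.
  apply/negP => /= cyc; pose r a b := (f (tl b) < f (tl a))%N.
  have r_tr : transitive r by move=> b a' c'; rewrite /r => h1 h2; apply: ltn_trans h2 h1.
  have sub_r : subrel (@composable Q) r by move=> a1 b1 /eqP e; rewrite /r -e; exact: fP.
  have /allP/(_ a) := order_path_min r_tr (sub_path sub_r cyc).
  by rewrite mem_rcons mem_head /r ltnn => /(_ isT).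
pose g v w := [exists a : arrow Q, (tl a == v) && (hd a == w)].
exists (fun v => #|connect g v|) => a.
have ga : g (tl a) (hd a) by apply/existsP; exists a; rewrite !eqxx.
apply: proper_card; apply/properP; split.
  by apply/subsetP => w; apply: connect_trans; apply: connect1.
exists (tl a); first exact: connect0.
apply/negP => /connectP [p gp lp].
have [c [ca lc]] : exists c, path (@composable Q) a c /\ hd (last a c) = tl a.
  elim: p {1 3 4 5}a gp lp {ga} => [|w p IH] b /=.
    by move=> _ lp; exists [::]; rewrite lp.
  case/andP=> /existsP [a1 /andP[/eqP tb /eqP hw]]; rewrite -hw => gp lp.
  have [c [cp lc]] := IH a1 gp lp.
  by exists (a1 :: c); rewrite /= /composable tb eqxx.
have /negP := acQ (a :: c) isT; apply.
by rewrite /= rcons_path ca /composable lc eqxx.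
Qed.

Lemma sort_key_index (T : eqType) (key : T -> nat) (s : seq T) x y :
  x \in s -> y \in s -> (key x < key y)%N ->
  (index x (sort (relpre key leq) s) < index y (sort (relpre key leq) s))%N.
Proof.
move=> xs ys; rewrite !ltnNge; apply: contra => h.
have tr : transitive (relpre key leq) by move=> a b c; apply: leq_trans.
have := sorted_leq_index tr (fun a => leqnn (key a))
  (sort_sorted (fun a b => leq_total (key a) (key b)) s).
by move=> /(_ y x); rewrite !mem_sort; apply.
Qed.

Lemma pairwise_index (T : eqType) (r : rel T) (s : seq T) x y :
  pairwise r s -> y \in s -> (index x s < index y s)%N -> r x y.
Proof.
move=> rs ys xy; have xs : x \in s.
  by rewrite -index_mem; apply: ltn_trans xy _; rewrite index_mem.
have /(pairwiseP x)/(_ (index x s) (index y s)) := rs.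
by rewrite !inE !index_mem !nth_index // => ->.
Qed.

Lemma index_pairwise (T : eqType) (r : rel T) (s : seq T) : uniq s ->
  {in s &, forall x y, (index x s < index y s)%N -> r x y} -> pairwise r s.
Proof.
case: s => // x0 s us h; apply/(pairwiseP x0) => i j i_s j_s ij.
by apply: h; rewrite ?mem_nth // !index_uniq.
Qed.

(** * The forms of a quiver *)

Section QuiverForm.

Variable K : quiver.

Definition mult (v w : vertex K) : int :=
  \sum_(a : arrow K) ((tl a == v) && (hd a == w))%:R.

Definition adj (v w : vertex K) : int := mult v w + mult w v.

Lemma adjC v w : adj v w = adj w v.
Proof. by rewrite /adj addrC. Qed.

Lemma mult_ge0 v w : 0 <= mult v w.
Proof. by apply: sumr_ge0 => a _; apply: ler0n. Qed.

Lemma adj_ge0 v w : 0 <= adj v w.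
Proof. by rewrite addr_ge0 ?mult_ge0. Qed.

Lemma sum_arrowE (F : vertex K -> vertex K -> int) :
  \sum_(a : arrow K) F (tl a) (hd a) = \sum_v \sum_w mult v w * F v w.
Proof.
transitivity (\sum_(a : arrow K) \sum_v \sum_w
    ((tl a == v) && (hd a == w))%:R * F v w).
  apply: eq_bigr => a _; rewrite (bigD1 (tl a)) //= (bigD1 (hd a)) //= !eqxx mul1r.
  rewrite big1 => [|w wh]; last by rewrite eq_sym (negbTE wh) mul0r.
  rewrite big1 ?addr0 // => v vt; rewrite big1 // => w _.
  by rewrite eq_sym (negbTE vt) mul0r.
rewrite exchange_big; apply: eq_bigr => v _; rewrite exchange_big.
by apply: eq_bigr => w _; rewrite mulr_suml.
Qed.

Lemma reflectionE i x : reflection i x = refl adj i x.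
Proof.
apply/ffunP=> v; rewrite !ffunE; case: eqP => // _; congr (_ - _).
have S1 : \sum_(a | tl a == i) x (hd a) = \sum_w mult i w * x w.
  rewrite big_mkcond (eq_bigr (fun a : arrow K => (tl a == i)%:R * x (hd a))).
    rewrite (sum_arrowE (fun v w => (v == i)%:R * x w)) (bigD1 i) //= [X in _ + X]big1.
      by rewrite addr0; apply: eq_bigr => w _; rewrite eqxx mul1r.
    by move=> u /negbTE ui; rewrite big1 // => w _; rewrite ui mul0r mulr0.
  by move=> a _; case: eqP; rewrite ?mul1r ?mul0r.
have S2 : \sum_(a | hd a == i) x (tl a) = \sum_w mult w i * x w.
  rewrite big_mkcond (eq_bigr (fun a : arrow K => (hd a == i)%:R * x (tl a))).
    rewrite (sum_arrowE (fun v w => (w == i)%:R * x v)); apply: eq_bigr => u _.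
    rewrite (bigD1 i) //= [X in _ + X]big1 ?eqxx ?mul1r ?addr0 // => w /negbTE wi.
    by rewrite wi mul0r mulr0.
  by move=> a _; case: eqP; rewrite ?mul1r ?mul0r.
rewrite S1 S2 -big_split; apply: eq_bigr => w _; by rewrite /adj mulrDl.
Qed.

Definition zvec (d : dimvec K) : {ffun vertex K -> int} := [ffun v => (d v)%:Z].

Lemma zvec_inj : injective zvec.
Proof.
move=> d d' /ffunP e; apply/ffunP=> v; have := e v.
by rewrite !ffunE => -[].
Qed.

Lemma zvec_nonneg d : nonneg (zvec d).
Proof. by apply/forallP=> v; rewrite ffunE. Qed.

Lemma euler_alongE (l : seq (vertex K)) (d d' : dimvec K) :
    perm_eq l (index_enum (vertex K)) ->
    (forall a : arrow K, (index (tl a) l < index (hd a) l)%N) ->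
  euler d d' = euler_along adj l (zvec d) (zvec d').
Proof.
move=> pl topo; have ul : uniq l by rewrite (perm_uniq pl) index_enum_uniq.
have mult0 v w : (index w l <= index v l)%N -> mult v w = 0.
  move=> wv; apply: big1 => a _; case: andP => // -[/eqP ta /eqP ha].
  by have := topo a; rewrite ta ha ltnNge wv.
set x := zvec d; set y := zvec d'.
have -> : euler d d' =
    \sum_(v <- l) x v * y v - \sum_(v <- l) \sum_(w <- l) mult v w * (x v * y w).
  rewrite /euler (perm_big _ pl) /=; congr (_ - _).
    by apply: eq_bigr => v _; rewrite !ffunE.
  rewrite [RHS](perm_big _ pl) /=.
  under [RHS]eq_bigr do rewrite (perm_big _ pl) /=.
  rewrite -(sum_arrowE (fun v w => x v * y w)).
  by apply: eq_bigr => a _; rewrite !ffunE.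
have : pairwise (fun v w => mult w v == 0) l.
  by apply: index_pairwise => // v w _ _ vw; apply/eqP/mult0/ltnW.
have m0 v : mult v v = 0 by apply: mult0.
elim: l {pl topo ul mult0} => [|i l IH] /=; first by rewrite !big_nil subrr.
case/andP=> /allP il pw; rewrite -IH // !big_cons m0 mul0r add0r.
rewrite (_ : \sum_(j <- l) \sum_(w <- i :: l) mult j w * (x j * y w) =
   \sum_(j <- l) \sum_(w <- l) mult j w * (x j * y w)); last first.
  apply: eq_big_seq => j jl; rewrite big_cons (eqP (il j jl)) mul0r add0r //.
rewrite (_ : \sum_(w <- l) mult i w * (x i * y w) =
   x i * \sum_(w <- l) adj i w * y w); last first.
  rewrite mulr_sumr; apply: eq_big_seq => j jl.
  by rewrite /adj (eqP (il j jl)); ring.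
by ring.
Qed.

End QuiverForm.

(** * Ordering the positive roots of a Dynkin quiver *)

Section DynkinQuiver.

Variable K : quiver.
Hypothesis dynK : dynkin K.

Lemma dynkin_loopless (a : arrow K) : tl a != hd a.
Proof.
have [n [e [f [de _ h]]]] := dynK; apply/negP => /eqP ta.
have := h (tl a) (tl a); rewrite (dynkin_diagram_irr de) => /eqP.
by rewrite cards_eq0 => /eqP/setP/(_ a); rewrite !inE -ta !eqxx.
Qed.

Lemma dynkin_adj : exists (n : nat) (e : rel 'I_n) (f : vertex K -> 'I_n),
  [/\ dynkin_diagram e, bijective f & forall v w, adj v w = (e (f v) (f w))%:R].
Proof.
have [n [e [f [de bf h]]]] := dynK; exists n, e, f; split=> // v w.
have mult_diag (u : vertex K) : mult u u = 0.
  apply: big1 => a _; case: andP => // -[/eqP ta /eqP ha].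
  by have := dynkin_loopless a; rewrite ta ha eqxx.
have [<-|vw] := eqVneq v w; first by rewrite (dynkin_diagram_irr de) /adj mult_diag.
rewrite -h /adj /mult -big_split -sum1_card natr_sum [RHS]big_mkcond /=.
apply: eq_bigr => a _; rewrite inE.
case: eqP => [tv|_] /=; last first.
  by rewrite add0r; case: (_ && _).
case: eqP => [hw|_] /=; last first.
  by rewrite add0r; case: (_ && _).
by rewrite tv (negbTE vw) addr0.
Qed.

Lemma adj_diag (v : vertex K) : adj v v = 0.
Proof.
by have [n [e [f [de _ ->]]]] := dynkin_adj; rewrite (dynkin_diagram_irr de).
Qed.

Lemma dynkin_definite (x : {ffun vertex K -> int}) :
  x != 0 -> 0 < cartan (@adj K) x x.
Proof.
have [n [e [f [de [g fK gK] fE]]]] := dynkin_adj.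
apply: contraNT; rewrite -leNgt => x_le0.
have x0 := @dynkin_diagram_definite n e (x \o g) de.
apply/eqP/ffunP=> v; rewrite ffunE -[v]fK; apply: x0.
move: x_le0; congr (_ <= _); rewrite /cartan.
have gbij : {on xpredT, bijective g} by apply: onW_bij; exists f.
rewrite (reindex g gbij) /=; apply: eq_bigr => i _.
congr (_ * (_ - _)); rewrite /nbr_sum (reindex g gbij) /=.
by apply: eq_bigr => j _; rewrite fE !gK.
Qed.

Lemma dynkin_connect (v w : vertex K) : connect (fun u u' => 0 < adj u u') v w.
Proof.
have [n [e [f [de [g fK gK] fE]]]] := dynkin_adj.
have /connectP [p ep lp] := dynkin_diagram_connect de (f v) (f w).
apply/connectP; exists (map g p); last by rewrite -{1}[v]fK last_map -lp fK.
rewrite -[v]fK; apply: (homo_path _ ep) => i j ij.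
by rewrite fE !gK ij.
Qed.

Lemma root_cartan (x : {ffun vertex K -> int}) : Defs.root x -> cartan (@adj K) x x = 2.
Proof.
elim=> [i|i y _ IH]; last by rewrite reflectionE cartan_refl //; [exact: adjC|exact: adj_diag].
have -> : [ffun v => (v == i)%:R] = delta i 1 :> {ffun vertex K -> int}.
  by apply/ffunP=> v; rewrite !ffunE; case: eqP.
by rewrite cartan_delta nbr_sum_delta adj_diag ffunE eqxx; ring.
Qed.

Lemma enum_of_finite_image (T : eqType) (I : finType) (P : T -> Prop) (g : T -> I) :
  (forall x y, P x -> P y -> g x = g y -> x = y) ->
  exists s : seq T, uniq s /\ forall x, x \in s <-> P x.
Proof.
move=> g_inj.
suff /(_ (enum I)) [s us hs] : forall l : seq I, exists2 s : seq T,
    uniq s & forall x, x \in s <-> P x /\ g x \in l.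
  exists s; split=> // x; rewrite hs; split=> [[]//|Px].
  by rewrite mem_enum.
elim=> [|i l [s us hs]]; first by exists [::] => // x; split=> [|[]].
have [[x [Px gx x_s]]|no] := classic (exists x, [/\ P x, g x = i & x \notin s]).
  exists (x :: s); first by rewrite /= x_s.
  move=> y; rewrite !inE; split.
    by case/orP=> [/eqP ->|/hs[Py ->]]; rewrite ?gx ?eqxx ?orbT.
  case=> Py /orP[/eqP gy|yl]; last by apply/orP; right; apply/hs.
  by rewrite (g_inj y x) ?eqxx // gx.
exists s => // y; rewrite hs inE; split=> [[Py ->]|[Py]]; first by rewrite orbT.
case/orP=> [/eqP gy|yl //]; apply/hs/negbNE/negP => ys.
by apply: no; exists y.
Qed.

Lemma walk_escapes_bound (l : seq (vertex K)) (F : seq (dimvec K)) :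
    perm_eq l (index_enum (vertex K)) -> {in F, forall d, positive_root d} ->
  exists N, {in F, forall d, exists2 k, (k <= N)%N &
    ~~ nonneg (walk (@adj K) k l (zvec d))}.
Proof.
move=> pl; elim: F => [|d F IH] hF; first by exists 0%N.
have [|N hN] := IH; first by move=> d' d'F; apply: hF; rewrite inE d'F orbT.
have [k hk] := walk_escapes (@adjC K) adj_diag dynkin_definite pl
  (root_cartan (hF d (mem_head _ _))).
exists (maxn N k) => d'; rewrite inE => /orP[/eqP ->|/hN [k' k'N hk']].
  by exists k; rewrite ?leq_maxr.
by exists k' => //; apply: leq_trans k'N (leq_maxl _ _).
Qed.

Lemma positive_root_sorting (f : vertex K -> nat) :
    (forall a : arrow K, (f (hd a) < f (tl a))%N) ->
  exists s : seq (dimvec K), [/\ uniq s, forall d, d \in s <-> positive_root d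
    & pairwise (fun d d' => 0 <= lambda d d') s].
Proof.
move=> f_rank; pose M := \max_v f v; have fM v : (f v <= M)%N by apply: leq_bigmax.
pose key v := (M - f v)%N.
pose l := sort (relpre key leq) (index_enum (vertex K)).
have pl : perm_eq l (index_enum (vertex K)) by rewrite perm_sort.
have topo (a : arrow K) : (index (tl a) l < index (hd a) l)%N.
  apply: sort_key_index; rewrite ?mem_index_enum // /key.
  by have := f_rank a; have := fM (tl a); lia.
have [x y Px Py e|F [uF hF]] := @enum_of_finite_image (dimvec K) _
    (@positive_root K) (fun d => residues (zvec d)).
  apply: zvec_inj; apply: (residues_inj (@adjC K) dynkin_definite _ _ e);
  exact: root_cartan.
have [N hN] := walk_escapes_bound pl (fun d dF => proj1 (hF d) dF).
have [|s ps os] := lambda_along_sorting (N := N) (@adjC K) adj_diag (@adj_ge0 K)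
    dynkin_definite pl (@zvec_inj K) uF.
  move=> d dF; split; [exact: zvec_nonneg | | exact: hN].
  exact/root_cartan/hF.
exists s; split; first by rewrite (perm_uniq ps).
  by move=> d; rewrite (perm_mem ps).
apply: sub_pairwise os => d d'.
by rewrite /lambda_along /lambda !(euler_alongE _ _ pl topo).
Qed.

End DynkinQuiver.

(** * Dynkin partitions: from a rank function to an allowed ordering *)

Lemma lambdaE (Q : quiver) (x y : dimvec Q) :
  lambda x y = \sum_(a : arrow Q)
    ((x (tl a) * y (hd a))%:Z - (y (tl a) * x (hd a))%:Z).
Proof.
rewrite /lambda /euler sumrB.
rewrite (eq_bigr (fun v => (y v * x v)%:Z) (fun v _ => congr1 Posz (mulnC (x v) (y v)))).
by ring.
Qed.

Lemma sum_sig (T : finType) (A : {set T}) (R : nmodType) (F : T -> R) :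
  (forall x, x \notin A -> F x = 0) ->
  \sum_x F x = \sum_(u : {x | x \in A}) F (val u).
Proof.
move=> F0; rewrite (bigID (mem A)) /= [X in _ + X]big1 // addr0.
rewrite (reindex_omap (fun u : {x | x \in A} => val u) insub).
  by apply: eq_bigl => u; rewrite valK eqxx andbT (valP u).
by move=> a aS; rewrite insubT.
Qed.

Section Subquivers.

Variables (Q : quiver) (S : subquiver Q).

Lemma extend_in (d : dimvec (quiver_of S)) v (vS : v \in sq_vertex S) :
  extend d v = d (Sub v vS).
Proof. by rewrite ffunE insubT. Qed.

Lemma extend_val (d : dimvec (quiver_of S)) (u : vertex (quiver_of S)) :
  extend d (val u) = d u.
Proof. by rewrite ffunE valK. Qed.

Lemma extend_out (d : dimvec (quiver_of S)) v :
  v \notin sq_vertex S -> extend d v = 0%N.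
Proof. by move=> vS; rewrite ffunE insubN. Qed.

Lemma extend_inj : injective (@extend Q S).
Proof.
by move=> d d' e; apply/ffunP=> u; rewrite -!extend_val e.
Qed.

End Subquivers.

Section Partition.

Variables (Q : quiver) (P : dynkin_partition Q).

Lemma block_in v : v \in sq_vertex (dp_part P (block P v)).
Proof. exact: xchooseP (@dp_cover Q P v). Qed.

Lemma block_uniq v j j' : v \in sq_vertex (dp_part P j) ->
  v \in sq_vertex (dp_part P j') -> j = j'.
Proof.
move=> vj vj'; apply/eqP; apply: contraTT vj' => jj'.
by have /disjointFr -> := dp_disjoint jj'.
Qed.

Lemma blockE v j : v \in sq_vertex (dp_part P j) -> block P v = j.
Proof. exact: block_uniq (block_in v). Qed.

Lemma cross_arrow a j j' : tl a \in sq_vertex (dp_part P j) ->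
    hd a \in sq_vertex (dp_part P j') -> j != j' ->
  exists c : arrow (contraction P), tl c = j /\ hd c = j'.
Proof.
move=> ta ha jj'.
have out : a \notin \bigcup_k sq_arrow (dp_part P k).
  apply: contraNN jj' => /bigcupP [k _ ak].
  by rewrite (block_uniq ta (sq_tl ak)) (block_uniq ha (sq_hd ak)).
by exists (Sub a out); rewrite /= (blockE ta) (blockE ha).
Qed.

Lemma loopless_full (lP : loopless (contraction P)) a j :
    tl a \in sq_vertex (dp_part P j) -> hd a \in sq_vertex (dp_part P j) ->
  a \in sq_arrow (dp_part P j).
Proof.
move=> ta ha; have [/bigcupP [k _ ak]|out] := boolP (a \in \bigcup_k sq_arrow (dp_part P k)).
  by rewrite (block_uniq ta (sq_tl ak)).
have := lP (Sub a out); rewrite /= (blockE ta) (blockE ha) eqxx //.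
Qed.

(** Without loops in the contraction the parts are full subquivers, so the form
of Q restricts to that of the part. *)
Lemma lambda_extend (lP : loopless (contraction P)) j
    (x y : dimvec (quiver_of (dp_part P j))) :
  lambda (extend x) (extend y) = lambda x y.
Proof.
rewrite !lambdaE (sum_sig (A := sq_arrow (dp_part P j))).
  by apply: eq_bigr => a _; rewrite -!extend_val.
move=> a aS; have [ta|ta] := boolP (tl a \in sq_vertex (dp_part P j)); last first.
  by rewrite !(extend_out _ ta) !mul0n.
have [ha|ha] := boolP (hd a \in sq_vertex (dp_part P j)); last first.
  by rewrite !(extend_out _ ha) !muln0.
by rewrite (loopless_full lP ta ha) in aS.
Qed.

Lemma Phi_part_support j d v : Phi_part P j d -> d v != 0%N ->
  v \in sq_vertex (dp_part P j).
Proof. by case=> d' _ ->; apply: contraR => /extend_out ->. Qed.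

Lemma Phi_part_neq0 j d : Phi_part P j d -> exists v, d v != 0%N.
Proof.
case=> d' rd ->; apply: NNPP => no.
have := root_cartan (dp_dynkin j) rd; rewrite /cartan big1 // => u _.
rewrite ffunE (_ : d' u = 0%N) ?mul0r //; apply/eqP/negbNE/negP => du.
by apply: no; exists (val u); rewrite extend_val.
Qed.

Lemma Phi_part_uniq j j' d : Phi_part P j d -> Phi_part P j' d -> j = j'.
Proof.
move=> dj dj'; have [v dv] := Phi_part_neq0 dj.
exact: block_uniq (Phi_part_support dj dv) (Phi_part_support dj' dv).
Qed.

Definition contraction_rank (g : 'I_(dp_size P) -> nat) : Prop :=
  forall c : arrow (contraction P), (g (hd c) < g (tl c))%N.

Lemma contraction_rank_loopless g : contraction_rank g -> loopless (contraction P).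
Proof. by move=> gP c; apply: contraTneq (gP c) => ->; rewrite ltnn. Qed.

Lemma Phi_part_sorting (acQ : acyclic Q) (lP : loopless (contraction P)) j :
  exists s : seq (dimvec Q), [/\ uniq s, forall d, d \in s <-> Phi_part P j d
    & pairwise (fun d d' => 0 <= lambda d d') s].
Proof.
have [f fP] := (acyclicP Q).1 acQ.
have [|s [us hs os]] := positive_root_sorting (dp_dynkin j) (f := f \o val).
  by move=> a; apply: fP.
exists [seq extend d | d <- s]; split.
- by rewrite map_inj_uniq //; apply: extend_inj.
- move=> d; split=> [/mapP [d' /hs d's ->]|[d' /hs d's ->]]; first by exists d'.
  by apply/mapP; exists d'.
- by rewrite pairwise_map; apply: sub_pairwise os => x y; rewrite /= lambda_extend.
Qed.

(** The roots are sorted by the key (g j) N + (position in the list of block j),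
where [N] bounds the lengths of these lists. *)
Lemma rank_ordering (acQ : acyclic Q) g : contraction_rank g ->
  exists s : seq (dimvec Q), [/\ total_ordering P s, condition_i P s
    & forall (j j' : 'I_(dp_size P)) (x y : dimvec Q),
        (g j < g j')%N -> Phi_part P j x -> Phi_part P j' y -> precedes s x y].
Proof.
move=> gP; have lP := contraction_rank_loopless gP.
have [L hL] := fin_all_exists (Phi_part_sorting acQ lP).
pose N := (\max_j size (L j)).
pose key x := (\sum_j (x \in L j) * (g j * N + index x (L j)))%N.
have LP j x : Phi_part P j x -> x \in L j by case: (hL j) => _ h _ /h.
have keyE j x : Phi_part P j x -> key x = (g j * N + index x (L j))%N.
  move=> xj; rewrite /key (bigD1 j) //= (LP _ _ xj) mul1n big1 ?addn0 // => k kj.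
  case: (boolP (x \in L k)) => // xk; case/eqP: kj.
  by apply: Phi_part_uniq xj; case: (hL k) => _ h _; apply/h.
have key_lt j x : Phi_part P j x -> (g j * N <= key x < (g j).+1 * N)%N.
  move=> xj; rewrite (keyE _ _ xj) leq_addr mulSn addnC ltn_add2r.
  apply: leq_trans (leq_bigmax j); by rewrite index_mem LP.
pose A := undup (flatten [seq L j | j <- enum 'I_(dp_size P)]).
have memA x : x \in A <-> Phi P x.
  rewrite mem_undup; split=> [/flattenP [_ /mapP [j _ ->] xj]|[j xj]].
    by exists j; case: (hL j) => _ h _; apply/h.
  by apply/flattenP; exists (L j); [apply: map_f; rewrite mem_enum|exact: LP].
exists (sort (relpre key leq) A); split.
- by split; [rewrite sort_uniq undup_uniq | move=> d; rewrite mem_sort].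
- move=> j x y xj yj; rewrite /precedes => xy.
  have [uL hLj oL] := hL j.
  have [xyL|yxL|e] := ltngtP (index x (L j)) (index y (L j)).
  + exact: pairwise_index oL (LP _ _ yj) xyL.
  + have : (key y < key x)%N by rewrite (keyE _ _ xj) (keyE _ _ yj) ltn_add2l.
    have Ay : y \in A by apply/memA; exists j.
    have Ax : x \in A by apply/memA; exists j.
    by move/(sort_key_index Ay Ax)/ltnW; rewrite leqNgt xy.
  + have := nth_index x (LP _ _ xj); rewrite e nth_index ?LP // => yx.
    by move: xy; rewrite yx ltnn.
- move=> j j' x y jj' xj yj'; apply: sort_key_index;
    [by apply/memA; exists j | by apply/memA; exists j' |].
  have /andP[_ h1] := key_lt _ _ xj; have /andP[h2 _] := key_lt _ _ yj'.
  apply: leq_trans h1 (leq_trans _ h2); by rewrite leq_mul2r jj' orbT.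
Qed.

Lemma lambdaN (x y : dimvec Q) : lambda x y = - lambda y x.
Proof. by rewrite /lambda; lia. Qed.

Lemma lambda_no_arrow (x y : dimvec Q) :
    (forall a : arrow Q, x (tl a) != 0%N -> y (hd a) = 0%N) ->
  lambda x y = - \sum_(a : arrow Q) (y (tl a) * x (hd a))%:Z.
Proof.
move=> h; rewrite lambdaE -sumrN; apply: eq_bigr => a _.
by have [->|/h ->] := eqVneq (x (tl a)) 0%N; rewrite ?mul0n ?muln0 sub0r.
Qed.

Lemma lambda_le0 (x y : dimvec Q) :
  (forall a : arrow Q, x (tl a) != 0%N -> y (hd a) = 0%N) -> lambda x y <= 0.
Proof. by move/lambda_no_arrow ->; rewrite oppr_le0 sumr_ge0. Qed.

Lemma lambda_lt0 (x y : dimvec Q) (b : arrow Q) :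
    (forall a : arrow Q, x (tl a) != 0%N -> y (hd a) = 0%N) ->
  y (tl b) != 0%N -> x (hd b) != 0%N -> lambda x y < 0.
Proof.
move=> /lambda_no_arrow -> yb xb; rewrite oppr_lt0 (bigD1 b) //=.
by rewrite ltr_pwDl ?sumr_ge0 // ltz_nat muln_gt0 !lt0n yb.
Qed.

Lemma rank_ordering_allowed g s : contraction_rank g -> total_ordering P s ->
    condition_i P s ->
    (forall (j j' : 'I_(dp_size P)) (x y : dimvec Q),
        (g j < g j')%N -> Phi_part P j x -> Phi_part P j' y -> precedes s x y) ->
  allowed_ordering P s.
Proof.
move=> gP ts ci gs; split=> // j j' x y jj' xj yj' xy.
apply: lambda_le0 => a xa; apply/eqP/negbNE/negP => ya.
have [c [tc hc]] := cross_arrow (Phi_part_support xj xa) (Phi_part_support yj' ya) jj'.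
have := gP c; rewrite tc hc => /gs /(_ yj' xj).
by move: xy; rewrite /precedes => xy /(ltn_trans xy); rewrite ltnn.
Qed.

End Partition.

(** * Geodesic paths *)

Section Geodesics.

Variables (T : eqType) (e : rel T).

Definition geodesic (x : T) (p : seq T) : Prop :=
  path e x p /\
  forall p', path e x p' -> last x p' = last x p -> (size p <= size p')%N.

Lemma geodesic_cat x p1 p2 : geodesic x (p1 ++ p2) ->
  geodesic x p1 /\ geodesic (last x p1) p2.
Proof.
case; rewrite cat_path last_cat => /andP[ep1 ep2] short; split; split=> // p' ep' lp'.
  by have := short (p' ++ p2);
  rewrite cat_path last_cat lp' ep' ep2 !size_cat => /(_ isT erefl); lia.
by have := short (p1 ++ p');
rewrite cat_path last_cat lp' ep1 ep' !size_cat => /(_ isT erefl); lia.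
Qed.

Lemma geodesic_behead x y p : geodesic x (y :: p) -> geodesic y p.
Proof. by rewrite -cat1s => /geodesic_cat []. Qed.

Lemma geodesic_head x y p : geodesic x (y :: p) ->
  x \notin y :: p /\ {in p, forall z, ~~ e x z}.
Proof.
move=> [/= /andP[exy ep] short]; split=> [|z zp].
  apply/negP => xp; case/splitPl: xp (ep) short => p1 p2 lp1.
  rewrite cat_path => /andP[_ ep2] /(_ p2).
  by rewrite lp1 in ep2 *; rewrite last_cat lp1 /= size_cat => /(_ ep2 erefl); lia.
case/splitPr: zp ep short => p1 p2; rewrite cat_path /= => /and3P[_ _ ep2] short.
apply/negP => exz; have := short (z :: p2).
by rewrite /= exz ep2 last_cat /= size_cat /= => /(_ isT erefl); lia.
Qed.

(** A geodesic is an induced path: between an initial and the remaining final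
segment there is no edge besides the one at the junction. *)
Lemma geodesic_junction x p1 y p2 : geodesic x (p1 ++ y :: p2) ->
  forall u w, u \in x :: p1 -> w \in y :: p2 ->
    u != w /\ (e u w -> u = last x p1 /\ w = y).
Proof.
elim: p1 x => [|z p1 IH] x gp u w up wp.
  have [xp xe] := geodesic_head gp; move: up; rewrite inE => /eqP ->.
  split; first by apply: contraNneq xp => ->.
  by move: wp; rewrite inE => /orP[/eqP -> //|/xe /negbTE ->].
have [xp xe] := geodesic_head gp.
move: up; rewrite inE => /orP[/eqP ->|up]; last exact: IH (geodesic_behead gp) _ _ up wp.
split; last by rewrite (negbTE (xe w _)) // mem_cat wp orbT.
by apply: contraNneq xp => ->; rewrite inE mem_cat wp !orbT.
Qed.

Lemma split_path (r : rel T) x p :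
  (forall p1 y p2, p = p1 ++ y :: p2 -> r (last x p1) y) -> path r x p.
Proof.
elim: p x => //= y p IH x h; rewrite (h [::] y p) //=.
by apply: IH => p1 z p2 p_eq; apply: (h (y :: p1) z p2); rewrite p_eq.
Qed.

Lemma path_crossing (A : pred T) x p : path e x p -> A x -> ~~ A (last x p) ->
  exists y z, [/\ e y z, A y & ~~ A z].
Proof.
elim: p x => [|y p IH] x /=; first by move=> _ ->.
case/andP=> exy ep Ax; have [Ay|nAy] := boolP (A y); first exact: IH.
by exists x, y.
Qed.

End Geodesics.

(** * Roots with prescribed support *)

Section BlockRoots.

Variables (Q : quiver) (P : dynkin_partition Q).
Hypothesis lP : loopless (contraction P).

Definition indicator (p : seq (vertex Q)) : dimvec Q := [ffun v => nat_of_bool (v \in p)].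

Definition block_adj j : rel (vertex Q) := fun v w =>
  [&& v \in sq_vertex (dp_part P j), w \in sq_vertex (dp_part P j) & 0 < adj v w].

Lemma adj_sub j (u w : vertex (quiver_of (dp_part P j))) :
  adj u w = adj (val u) (val w).
Proof.
have mE (u' w' : vertex (quiver_of (dp_part P j))) : mult u' w' = mult (val u') (val w').
  rewrite /mult [RHS](sum_sig (A := sq_arrow (dp_part P j))) //.
  move=> a; case: andP => // -[/eqP ta /eqP ha] /negP[].
  by apply: loopless_full; rewrite // ?ta ?ha ?(valP u') ?(valP w').
by rewrite /adj !mE.
Qed.

Lemma block_adj1 j v w : v \in sq_vertex (dp_part P j) ->
  w \in sq_vertex (dp_part P j) -> adj v w = (block_adj j v w)%:R.
Proof.
move=> vj wj; rewrite /block_adj vj wj -[v]/(val (Sub v vj : {v | _})).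
rewrite -[w]/(val (Sub w wj : {w | _})) -adj_sub.
by have [n [e [f [_ _ ->]]]] := dynkin_adj (dp_dynkin j); case: (e _ _).
Qed.

Lemma block_connect j v w : v \in sq_vertex (dp_part P j) ->
  w \in sq_vertex (dp_part P j) -> connect (block_adj j) v w.
Proof.
move=> vj wj.
have /connectP [p ep lp] := dynkin_connect (dp_dynkin j) (Sub v vj) (Sub w wj).
apply/connectP; exists (map val p); last first.
  by rewrite -[v]/(val (Sub v vj : {v | _})) last_map -lp.
rewrite -[v]/(val (Sub v vj : {v | _})); apply: (homo_path _ ep) => u u' uu'.
by rewrite /block_adj -adj_sub uu' (valP u) (valP u').
Qed.

Lemma Phi_part_simple j v : v \in sq_vertex (dp_part P j) ->
  Phi_part P j (indicator [:: v]).
Proof.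
move=> vj; exists [ffun u => nat_of_bool (u == Sub v vj)].
  rewrite /positive_root (_ : [ffun _ => _] = [ffun u => (u == Sub v vj)%:R]).
    exact: root_simple.
  by apply/ffunP=> u; rewrite !ffunE; case: eqP.
apply/ffunP=> u; rewrite !ffunE inE; case: insubP => [u' uj <-|].
  by rewrite ffunE -val_eqE.
by case: eqP => // ->; rewrite vj.
Qed.

(** A vertex outside the support of a root is added by reflecting at it. *)
Lemma Phi_part_grow j d v c : Phi_part P j d -> v \in sq_vertex (dp_part P j) ->
    d v = 0%N -> c%:Z = \sum_w adj v w * (d w)%:Z ->
  Phi_part P j [ffun u => if u == v then c else d u].
Proof.
case=> d' rd -> vj dv cE; pose i : vertex (quiver_of (dp_part P j)) := Sub v vj.
exists [ffun u => if u == i then c else d' u]; last first.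
  apply/ffunP=> u; rewrite ffunE.
  have [uj|uj] := boolP (u \in sq_vertex (dp_part P j)).
    by rewrite !(extend_in _ uj) ffunE -val_eqE.
  by rewrite !(extend_out _ uj); case: eqP uj => // ->; rewrite vj.
rewrite /positive_root (_ : [ffun _ => _] = reflection i [ffun u => (d' u)%:Z]).
  exact: root_reflection.
rewrite reflectionE; apply/ffunP=> u; rewrite !ffunE; case: (u == i) => //.
have -> : d' i = 0%N by rewrite -dv -[v]/(val i) extend_val.
rewrite subr0 cE (sum_sig (A := sq_vertex (dp_part P j))); last first.
  by move=> w wj; rewrite extend_out // mulr0.
by apply: eq_bigr => w _; rewrite ffunE extend_val adj_sub.
Qed.

(** The first vertex of a geodesic has exactly one neighbour among the others,
which is joined to it by a single arrow, so reflecting at it adds it with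
coefficient 1. *)
Lemma Phi_part_geodesic j x p : x \in sq_vertex (dp_part P j) ->
  geodesic (block_adj j) x p -> Phi_part P j (indicator (x :: p)).
Proof.
elim: p x => [|y p IH] x xj gp; first exact: Phi_part_simple.
have [[/= /andP[exy ep] _] [xp xe]] := (gp, geodesic_head gp).
have yj : y \in sq_vertex (dp_part P j) by case/and3P: exy.
have pj w : w \in p -> w \in sq_vertex (dp_part P j).
  move=> wp; have := allP (_ : all (mem (sq_vertex (dp_part P j))) p) w wp.
  apply; elim: p y ep {wp gp xp xe IH exy yj} => //= z p IH y /andP[/and3P[_ -> _]].
  exact: IH.
have -> : indicator [:: x, y & p] =
    [ffun u => if u == x then 1%N else indicator (y :: p) u].
  by apply/ffunP=> u; rewrite !ffunE inE; case: eqP.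
apply: Phi_part_grow => //; first exact: IH (geodesic_behead gp).
  by rewrite ffunE (negbTE xp).
rewrite (bigD1 y) //= ffunE mem_head mulr1 (block_adj1 xj yj) exy big1 ?addr0 //.
move=> w wy; rewrite ffunE inE (negbTE wy) /=; have [wp|] := boolP (w \in p).
  by rewrite (block_adj1 xj (pj w wp)) (negbTE (xe w wp)) mul0r.
by rewrite mulr0.
Qed.

(** While the support of a root is a proper subset of a connected block, some
edge leaves it, and reflecting at the far end of that edge enlarges it. *)
Lemma Phi_part_full j : exists d, Phi_part P j d /\
  forall v, v \in sq_vertex (dp_part P j) -> d v != 0%N.
Proof.
pose S := sq_vertex (dp_part P j).
suff /(_ #|S|.+1) [d dj [d_gt|full]] : forall n, exists2 d, Phi_part P j d &
    (n <= #|[set v | d v != 0%N]|)%N \/ forall v, v \in S -> d v != 0%N.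
- have /subset_leq_card : [set v | d v != 0%N] \subset S.
      by apply/subsetP => v; rewrite inE; apply: Phi_part_support.
    by rewrite leqNgt d_gt.
- by exists d.
elim=> [|n [d dj [d_ge|?]]]; last by exists d => //; right.
- have [n [e [f [de [g _ _] _]]]] := dp_dynkin j.
  pose u := g (Ordinal (dynkin_diagram_card de)).
  by exists (indicator [:: val u]); [exact: Phi_part_simple (valP u)|left].
have [full|/forall_inPn /= [w wS dw]] := boolP [forall (v | v \in S), d v != 0%N].
  by exists d => //; right=> v vS; apply: (forall_inP full).
have [v dv] := Phi_part_neq0 dj; have vS := Phi_part_support dj dv.
have /connectP [p ep lp] := block_connect vS wS.
have [||y [z [/and3P[yS zS yz] dy dz]]] := path_crossing (A := fun v => d v != 0%N) ep.
- exact: dv.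
- by rewrite -lp.
pose c := absz (\sum_w' adj z w' * (d w')%:Z).
have cE : c%:Z = \sum_w' adj z w' * (d w')%:Z.
  by rewrite /c gez0_abs // sumr_ge0 // => w' _; rewrite mulr_ge0 ?adj_ge0.
have c_gt0 : (0 < c)%N.
  rewrite -ltz_nat cE (bigD1 y) //= ltr_pwDl //; last first.
    by rewrite sumr_ge0 // => w' _; rewrite mulr_ge0 ?adj_ge0.
  by rewrite mulr_gt0 // ?ltz_nat ?lt0n // adjC.
exists [ffun u => if u == z then c else d u].
  by apply: Phi_part_grow => //; apply/eqP; rewrite -[_ == _]negbK.
left; apply: leq_ltn_trans d_ge _; apply/proper_card/properP; split.
  apply/subsetP => u; rewrite !inE ffunE; case: (u == z) => // _.
  by rewrite -lt0n.
by exists z; rewrite inE // ffunE eqxx -lt0n.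
Qed.

End BlockRoots.

(** * From an allowed ordering to admissibility *)

Section AllowedOrdering.

Variables (Q : quiver) (P : dynkin_partition Q) (s : seq (dimvec Q)).
Hypothesis lP : loopless (contraction P).
Hypothesis allowed_s : allowed_ordering P s.

Lemma precedes_total j j' x y : Phi_part P j x -> Phi_part P j' y -> x != y ->
  precedes s x y || precedes s y x.
Proof.
case: allowed_s => -[_ ms] _ _ xj yj'; apply: contraNT.
rewrite negb_or /precedes -!leqNgt -eqn_leq eq_sym => /eqP e.
have xs : x \in s by apply/ms; exists j.
have ys : y \in s by apply/ms; exists j'.
by have := nth_index x xs; rewrite e nth_index // => ->.
Qed.

Lemma lambda_lt0_neq (x y : dimvec Q) : lambda x y < 0 -> x != y.
Proof. by apply: contraTneq => ->; rewrite /lambda subrr. Qed.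

Lemma cross_precedes j j' x y : j != j' -> Phi_part P j x -> Phi_part P j' y ->
  lambda x y < 0 -> precedes s x y.
Proof.
move=> jj' xj yj' l_lt; case/orP: (precedes_total xj yj' (lambda_lt0_neq l_lt)) => //.
case: allowed_s => _ _ cii; rewrite eq_sym in jj'.
by move/(cii _ _ _ _ jj' yj' xj); rewrite lambdaN oppr_le0 leNgt l_lt.
Qed.

Lemma inner_precedes j x y : Phi_part P j x -> Phi_part P j y ->
  lambda x y < 0 -> precedes s y x.
Proof.
move=> xj yj l_lt; case/orP: (precedes_total xj yj (lambda_lt0_neq l_lt)) => //.
by case: allowed_s => _ ci _ /(ci _ _ _ xj yj); rewrite leNgt l_lt.
Qed.

Lemma indicator_neq0 p (v : vertex Q) : (indicator p v != 0%N) = (v \in p).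
Proof. by rewrite ffunE eqb0 negbK. Qed.

Lemma lambda_indicator_lt0 p q (b : arrow Q) :
  (forall a : arrow Q, tl a \in p -> hd a \notin q) ->
  tl b \in q -> hd b \in p -> lambda (indicator p) (indicator q) < 0.
Proof.
move=> no bq bp; apply: (@lambda_lt0 _ _ _ b); rewrite ?indicator_neq0 // => a.
by rewrite indicator_neq0 => /no; rewrite -indicator_neq0 negbK => /eqP.
Qed.

(** A closed walk that leaves block [j] by [a] and returns to it by [b].  The
arrows [a] and [b] are oriented; the walks [p] and [q] inside the blocks ignore
the orientation. *)
Definition two_cycle j j' (a b : arrow Q) (p q : seq (vertex Q)) : Prop :=
  [/\ tl a \in sq_vertex (dp_part P j), hd a \in sq_vertex (dp_part P j'),
      path (block_adj j) (tl a) p /\ last (tl a) p = hd b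
    & path (block_adj j') (hd a) q /\ last (hd a) q = tl b].

Lemma block_adjC (j : 'I_(dp_size P)) : symmetric (block_adj j).
Proof. by move=> v w; rewrite /block_adj adjC andbCA. Qed.

Lemma block_path_in (j : 'I_(dp_size P)) x p : x \in sq_vertex (dp_part P j) ->
  path (block_adj j) x p -> {in x :: p, forall v, v \in sq_vertex (dp_part P j)}.
Proof.
elim: p x => [|y p IH] x xj /=; first by move=> _ v; rewrite inE => /eqP ->.
case/andP=> /and3P[_ yj _] py v; rewrite inE => /orP[/eqP -> //|].
exact: IH yj py v.
Qed.

(** Reversing both walks exchanges the two blocks, so that what is proved for
[p] also holds for the reverse of [q]. *)
Lemma two_cycle_sym j j' a b p q : two_cycle j j' a b p q ->
  two_cycle j' j b a (rev (belast (hd a) q)) (rev (belast (tl a) p)).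
Proof.
case=> ta ha [ep lp] [eq lq].
have revp (k : 'I_(dp_size P)) x r : path (block_adj k) x r ->
    path (block_adj k) (last x r) (rev (belast x r)) /\
    last (last x r) (rev (belast x r)) = x.
  move=> er; split; last by case: r {er} => //= y r; rewrite rev_cons last_rcons.
  rewrite rev_path; apply: sub_path er => v w; by rewrite block_adjC.
have := revp _ _ _ ep; have := revp _ _ _ eq; rewrite lp lq => hq hp.
split=> //; first by rewrite -lq (block_path_in ha eq) ?mem_last.
by rewrite -lp (block_path_in ta ep) ?mem_last.
Qed.

Section MinimalTwoCycle.

Variables (f : vertex Q -> nat) (j j' : 'I_(dp_size P)) (a b : arrow Q).
Variables (p q : seq (vertex Q)).
Hypothesis f_rank : forall c : arrow Q, (f (hd c) < f (tl c))%N.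
Hypothesis jj' : j != j'.
Hypothesis cyc : two_cycle j j' a b p q.
Hypothesis min : forall a' b' p' q', two_cycle j j' a' b' p' q' ->
  (size p + size q <= size p' + size q')%N.

(** An arrow leaving [p] later, or entering [q] later, than [a] could replace
[a] and shorten the closed walk. *)
Lemma min_arrow_out c : tl c \in tl a :: p -> hd c \in hd a :: q -> tl c = tl a.
Proof.
move=> tc hc; case: cyc min => ta ha [ep lp] [eq lq].
have tcj := block_path_in ta ep tc; have hcj := block_path_in ha eq hc.
case/splitPl: tc ep lp => p1 p2 lp1; case/splitPl: hc eq lq => q1 q2 lq1.
rewrite !cat_path !last_cat lp1 lq1 => /andP[_ eq2] lq2 /andP[_ ep2] lp2.
move/(_ c b p2 q2); rewrite !size_cat => short.
have /short le_pq : two_cycle j j' c b p2 q2 by [].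
have p10 : size p1 = 0%N.
  apply/eqP; rewrite -leqn0 -(leq_add2r (size p2 + size q2)).
  by apply: leq_trans le_pq; rewrite addnA leq_add2l leq_addl.
by rewrite -lp1 (size0nil p10).
Qed.

Lemma min_arrow_in c : tl c \in hd a :: q -> hd c \in tl a :: p ->
  hd c = last (tl a) p.
Proof.
move=> tc hc; case: cyc min => ta ha [ep lp] [eq lq].
case/splitPl: hc ep lp => p1 p2 lp1; case/splitPl: tc eq lq => q1 q2 lq1.
rewrite !cat_path !last_cat => /andP[eq1 _] _ /andP[ep1 _] _.
move/(_ a c p1 q1); rewrite !size_cat => short.
have /short le_pq : two_cycle j j' a c p1 q1 by [].
have p20 : size p2 = 0%N.
  apply/eqP; rewrite -leqn0 -(leq_add2r (size p1 + size q1)).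
  by apply: leq_trans le_pq; rewrite addnA (addnC (size p2)) leq_add2l leq_addr.
by rewrite lp1 (size0nil p20).
Qed.

(** The rank [f] increases along [p], because all edges of [p] are oriented
backwards.  For a splitting p1, p2 of the walk, the root of p2 comes before the
root Y of [q], which comes before the root of p1; arrows from p1 to p2
only would put p1 before p2 by condition (i). *)
Lemma min_two_cycle_path : path (fun u v => (f u < f v)%N) (tl a) p.
Proof.
case: (cyc) => ta ha [ep lp] [eq lq].
have geo_p : geodesic (block_adj j) (tl a) p.
  split=> // p' ep' lp'; rewrite -(leq_add2r (size q)).
  by apply: (@min a b); split; rewrite // lp'.
have geo_q : geodesic (block_adj j') (hd a) q.
  split=> // q' eq' lq'; rewrite -(leq_add2l (size p)).
  by apply: (@min a b); split; rewrite // lq'.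
have Yj' := Phi_part_geodesic lP ha geo_q.
apply: split_path => p1 y p2 p_eq.
have := geo_p; rewrite p_eq => geo; have junction := geodesic_junction geo.
have [geo1 /geodesic_behead geo2] := geodesic_cat geo.
have yj : y \in sq_vertex (dp_part P j).
  by apply: (block_path_in ta ep); rewrite p_eq inE mem_cat mem_head !orbT.
have X1j := Phi_part_geodesic lP ta geo1.
have X2j := Phi_part_geodesic lP yj geo2.
have sub1 v : v \in tl a :: p1 -> v \in tl a :: p.
  by rewrite p_eq -cat_cons mem_cat => ->.
have sub2 v : v \in y :: p2 -> v \in tl a :: p.
  by rewrite p_eq -cat_cons mem_cat orbC => ->.
have last2 : last (tl a) p \in y :: p2 by rewrite p_eq last_cat /= mem_last.
have disj v : v \in tl a :: p1 -> v \in y :: p2 -> False.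
  by move=> v1 v2; have [] := junction _ _ v1 v2; rewrite eqxx.
have YX1 : precedes s (indicator (hd a :: q)) (indicator (tl a :: p1)).
  apply: (cross_precedes _ Yj' X1j); first by rewrite eq_sym.
  apply: (@lambda_indicator_lt0 _ _ a); rewrite ?mem_head // => c tc.
  by apply/negP => hc; apply: (disj _ hc); rewrite (min_arrow_in tc) ?sub1.
have X2Y : precedes s (indicator (y :: p2)) (indicator (hd a :: q)).
  apply: (cross_precedes jj' X2j Yj').
  apply: (@lambda_indicator_lt0 _ _ b).
  - move=> c tc; apply/negP => hc; apply: (disj (tl c)) => //.
    by rewrite (min_arrow_out (sub2 _ tc) hc) mem_head.
  - by rewrite -lq mem_last.
  - by rewrite -lp.
have X2X1 := ltn_trans X2Y YX1.
set u := last (tl a) p1.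
have uy : block_adj j u y by move: ep; rewrite p_eq cat_path => /andP[_ /andP[]].
have [/existsP [c /andP[/eqP <- /eqP <-]]|no_c] :=
  boolP [exists c : arrow Q, (tl c == y) && (hd c == u)]; first exact: f_rank.
have [c tc hc] : exists2 c : arrow Q, tl c = u & hd c = y.
  have mult0 : mult y u = 0.
    apply: big1 => c _; case: andP => // cyu; case/negP: no_c.
    by apply/existsP; exists c; apply/andP.
  case/and3P: uy => _ _; rewrite /adj mult0 addr0 => m_gt0; apply: NNPP => no.
  move: m_gt0; rewrite /mult big1 // => c _; case: andP => // -[/eqP tc /eqP hc].
  by case: no; exists c.
suff X1X2 : precedes s (indicator (tl a :: p1)) (indicator (y :: p2)).
  by have := ltn_trans X1X2 X2X1; rewrite ltnn.
apply: (inner_precedes X2j X1j); apply: (@lambda_indicator_lt0 _ _ c); last 2 first.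
- by rewrite tc mem_last.
- by rewrite hc mem_head.
move=> d td; apply/negP => hd1; have [_ jun] := junction _ _ hd1 td.
have [|hu ty] := jun; last first.
  by case/negP: no_c; apply/existsP; exists d; rewrite hu ty !eqxx.
rewrite /block_adj (block_path_in ta ep (sub1 _ hd1)) (block_path_in ta ep (sub2 _ td)).
rewrite /adj ltr_wpDl ?mult_ge0 // /mult (bigD1 d) //= !eqxx ltr_pwDl //.
by apply: sumr_ge0 => d' _.
Qed.

Lemma min_two_cycle_le : (f (tl a) <= f (hd b))%N.
Proof.
case: cyc => _ _ [_ <-] _; have := min_two_cycle_path.
elim: p (tl a) => //= v r IH u /andP[uv pv].
exact: leq_trans (ltnW uv) (IH _ pv).
Qed.

End MinimalTwoCycle.

Lemma no_two_cycle (f : vertex Q -> nat) j j' a b p q :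
    (forall c : arrow Q, (f (hd c) < f (tl c))%N) -> j != j' ->
  ~ two_cycle j j' a b p q.
Proof.
move=> f_rank jj'; have [n] := ubnP (size p + size q).
elim: n a b p q => // n IH a b p q; rewrite ltnS => pqn cyc.
have min a' b' p' q' : two_cycle j j' a' b' p' q' ->
    (size p + size q <= size p' + size q')%N.
  move=> cyc'; rewrite leqNgt; apply/negP => lt_pq.
  exact: (IH a' b' p' q' (leq_trans lt_pq pqn) cyc').
have le_ab := min_two_cycle_le f_rank jj' cyc min.
have le_ba : (f (tl b) <= f (hd a))%N.
  have j'j : j' != j by rewrite eq_sym.
  apply: (min_two_cycle_le f_rank j'j (two_cycle_sym cyc)) => a' b' p' q' /two_cycle_sym.
  by move/min; rewrite !size_rev !size_belast addnC [leqRHS]addnC.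
have := f_rank a; have := f_rank b; lia.
Qed.

Lemma allowed_ordering_admissible (acQ : acyclic Q) : admissible P.
Proof.
have [f f_rank] := (acyclicP Q).1 acQ.
have [d dP] := fin_all_exists (Phi_part_full lP).
apply/acyclicP; exists (fun j => index (d j) s) => c.
have jj' := lP c; set j := tl c in jj' *; set j' := hd c in jj' *.
have tcj : tl (val c) \in sq_vertex (dp_part P j) by apply: block_in.
have hcj : hd (val c) \in sq_vertex (dp_part P j') by apply: block_in.
have [dj fullj] := dP j; have [dj' fullj'] := dP j'.
have j'j : j' != j by rewrite eq_sym.
apply: (cross_precedes j'j dj' dj); apply: (@lambda_lt0 _ _ _ (val c)); last 2 first.
- exact: fullj.
- exact: fullj'.
move=> b tb; apply/eqP/negbNE/negP => hb.
have tbj' := Phi_part_support dj' tb; have hbj := Phi_part_support dj hb.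
have /connectP [p ep lp] := block_connect lP tcj hbj.
have /connectP [q eq lq] := block_connect lP hcj tbj'.
by apply: (@no_two_cycle f j j' (val c) b p q f_rank jj'); split.
Qed.

End AllowedOrdering.

(** * An admissible partition with two allowed orderings *)

Definition two_points : quiver := @Quiver 'I_2 void (of_void _) (of_void _).

Definition point (i : vertex two_points) : subquiver two_points :=
  @Subquiver two_points [set i] set0
    (fun a : void => of_void _ a) (fun a : void => of_void _ a).

Lemma dynkin_point i : dynkin (quiver_of (point i)).
Proof.
exists 1%N, (@typeA 1), (fun _ => ord0); split; first exact: Dynkin_A.
  exists (fun _ => Sub i (set11 i)) => [u|k]; last by rewrite [k]ord1.
  by apply: val_inj; case: u => u ui; apply/esym/set1P.
by move=> v w; rewrite eq_card0 // => -[[]].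
Qed.

Lemma disjoint_points i j : i != j ->
  [disjoint sq_vertex (point i) & sq_vertex (point j)].
Proof. by move=> ij; rewrite disjoints1; apply: contraNN ij => /set1P ->. Qed.

Lemma cover_points v : exists i, v \in sq_vertex (point i).
Proof. by exists v; rewrite /= inE. Qed.

Definition points : dynkin_partition two_points :=
  DynkinPartition dynkin_point disjoint_points cover_points.

Lemma admissible_points : admissible points.
Proof. by case=> // -[[]]. Qed.

Lemma lambda_two_points (x y : dimvec two_points) : lambda x y = 0.
Proof. by rewrite lambdaE big1 // => -[]. Qed.

(** Without arrows the form vanishes, so that every ordering is allowed. *)
Lemma rev_allowed_points s : allowed_ordering points s ->
  allowed_ordering points (rev s).
Proof.
case=> -[us ms] _ _; split; first split.
- by rewrite rev_uniq.
- by move=> d; rewrite mem_rev.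
- by move=> j x y _ _ _; rewrite lambda_two_points.
- by move=> j j' x y _ _ _ _; rewrite lambda_two_points.
Qed.

Lemma rev_neq (T : eqType) (s : seq T) x y :
  uniq s -> x \in s -> y \in s -> x != y -> s <> rev s.
Proof.
case: s => // a s /= /andP[a_s _]; case/lastP: s a_s => [|s b] a_s.
  by rewrite !inE => /eqP -> /eqP ->; rewrite eqxx.
move=> _ _ _; rewrite rev_cons rev_rcons /= => -[ab _].
by rewrite ab mem_rcons mem_head in a_s.
Qed.

Lemma acyclic_two_points : acyclic two_points.
Proof. by case=> // -[]. Qed.

Lemma admissible_allowed (Q : quiver) (P : dynkin_partition Q) :
  acyclic Q -> admissible P -> exists s, allowed_ordering P s.
Proof.
move=> acQ /acyclicP [g gP]; have [s [ts ci gs]] := rank_ordering acQ gP.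
by exists s; apply: rank_ordering_allowed gP ts ci gs.
Qed.

Lemma two_orderings : exists s1 s2, [/\ allowed_ordering points s1,
  allowed_ordering points s2 & s1 <> s2].
Proof.
have [s al] := admissible_allowed acyclic_two_points admissible_points.
exists s, (rev s); split; [by []|exact: rev_allowed_points|].
case: al => -[us ms] _ _.
have in_s (i : vertex two_points) : indicator [:: i] \in s.
  by apply/ms; exists i; exact: (@Phi_part_simple _ points i i (set11 i)).
apply: (rev_neq us (in_s ord0) (in_s ord_max)).
by apply/eqP => /ffunP/(_ ord0); rewrite !ffunE.
Qed.

(* The hypothesis [loopless (contraction P)] in the second clause cannot be
   dropped: if Q has two arrows a, b : 1 -> 2 and the only part has vertices
   1, 2 and the arrow a, then e_1 < e_1 + e_2 < e_2 is allowed, but b becomes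
   a loop of the contraction. The last clause expresses that an allowed
   ordering need not be unique; for some Q and P (e.g. one vertex) it is. *)
Theorem theorem2p6 :
  (forall (Q : quiver) (P : dynkin_partition Q), acyclic Q ->
     [/\ admissible P -> exists s : seq (dimvec Q), allowed_ordering P s,
         loopless (contraction P) ->
           (exists s : seq (dimvec Q), allowed_ordering P s) -> admissible P
       & ordered P ->
           (exists s : seq (dimvec Q), blockwise_ordering P s) /\
           (forall s : seq (dimvec Q),
              blockwise_ordering P s -> allowed_ordering P s)])
  /\
  (exists (Q : quiver) (P : dynkin_partition Q),
     [/\ acyclic Q, admissible P
       & exists s1 s2 : seq (dimvec Q),
           [/\ allowed_ordering P s1, allowed_ordering P s2 & s1 <> s2]]).
Proof.
split; last first.
  exists two_points, points; split.
  - exact: acyclic_two_points.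
  - exact: admissible_points.
  - exact: two_orderings.
move=> Q P acQ; split; first exact: admissible_allowed.
  by move=> lP [s al]; apply: (allowed_ordering_admissible lP al acQ).
move=> ordP; have gP : contraction_rank (P := P) (@nat_of_ord _) := ordP.
split=> [|s [ts ci gs]]; first by have [s hs] := rank_ordering acQ gP; exists s.
exact: rank_ordering_allowed gP ts ci gs.
Qed.
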